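(* For each $n \ge 1$ let $U_{1,n} \le U_{2,n} \le \dots \le U_{n,n}$ be the order statistics of $n$ i.i.d. random variables uniformly distributed on $[0,1]$. Then for every $t$ with $0 \le t \le 1$, $$\lim_{n \to \infty} \mathbb{P}\left\{ \min_{1 \le k \le n} \frac{2n}{k(k+1)} \sum_{i=1}^k U_{i,n} \ge t \right\} = \sqrt{1-t}\; e^{-t/2}.$$
   Context: The order statistics of a finite sample are its values arranged in nondecreasing order. *)

(* Defs.v *)
From HB Require Import structures.
From mathcomp Require Import all_boot all_order all_algebra.
From mathcomp Require Import all_classical all_reals all_analysis.

Set Implicit Arguments.
Unset Strict Implicit.
Unset Printing Implicit Defensive.

Import Order.TTheory GRing.Theory Num.Theory.
Import numFieldNormedType.Exports.

Local Open Scope classical_set_scope.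
Local Open Scope ring_scope.

Definition mutually_independent (d : measure_display) (T : measurableType d)
    (R : realType) (P : probability T R) (I : finType)
    (X : I -> {RV P >-> R}) : Prop :=
  forall (J : {set I}) (B : I -> set R),
    (forall i, i \in J -> measurable (B i)) ->
    P (\bigcap_(i in [set` J]) (X i @^-1` B i)) =
    (\prod_(i in J) P (X i @^-1` B i))%E.

(* The equality of laws is restricted to Borel sets: [distribution] and
   [uniform_prob] are total functions on [set R] whose values on
   non-measurable sets carry no meaning. *)
Definition uniform01 (d : measure_display) (T : measurableType d)
    (R : realType) (P : probability T R) (X : {RV P >-> R}) : Prop :=
  forall B : set R, measurable B ->
    distribution P X B = uniform_prob (@ltr01 R) B.

(* Order statistics are numbered from 1; the value is the default 0 when
   [k] is not in the range 1, ..., n. *)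
Definition order_statistic (R : realType) (T : Type) (n : nat)
    (X : 'I_n -> T -> R) (k : nat) (w : T) : R :=
  if k is k'.+1 then (sort <=%R [seq X i w | i <- enum 'I_n])`_k' else 0.

Definition scaled_partial_sum (R : realType) (T : Type) (n : nat)
    (X : 'I_n -> T -> R) (k : nat) (w : T) : R :=
  (2 * n)%:R / (k * k.+1)%:R * \sum_(1 <= i < k.+1) order_statistic X i w.

(* The neutral element of the iterated minimum is the term k = 1, so for
   n >= 1 this is the minimum of the terms k = 1, ..., n. *)
Definition min_scaled_partial_sum (R : realType) (T : Type) (n : nat)
    (X : 'I_n -> T -> R) (w : T) : R :=
  \big[Num.min/scaled_partial_sum X 1 w]_(1 <= k < n.+1)
    scaled_partial_sum X k w.

(* Main.v *)
(* For c = t / n the event says that every set A of indices satisfies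
   U(A) >= c g(|A|), where U(A) is the sum of the U_i over A and
   g(k) = k (k + 1) / 2, because the sum of the k smallest values is the least
   of the sums over k indices.  Let p(J, a, b) be the probability that, for
   the indices in J, U_i <= b and U(A) >= a |A| + c g(|A|) for all A in J.
   Splitting the cube [a, b]^J according to the smallest minimizer A of the
   submodular function A |-> U(A) - a |A| - c g(|A|), and using independence,
   gives
     (b - a)^|J| = sum over A in J of q(A, a) p(J \ A, a + c |A|, b),
   where q(A, a) is the probability that A itself is the strict minimizer
   among its subsets.  Reflecting the interval [a, a + c (|A| + 1)] shows that
   q(A, a) = p(A, a, a + c (|A| + 1)).  The two relations determine p by
   induction, and Cauchy's form of Abel's binomial identity shows that
     p(J, a, b) = m! [z^m] sqrt (1 - c z) exp (z (b - a - c / 2)),  m = |J|.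
   With J the whole index set, a = 0, b = 1 and c = t / n, the limit for t < 1
   follows by dominated convergence of the coefficient sums; the case t = 1
   follows because the probabilities are nonincreasing in t. *)
Require Import Defs.
From HB Require Import structures.
From mathcomp Require Import all_boot all_order all_algebra perm.
From mathcomp Require Import ring lra zify.

Set Implicit Arguments.
Unset Strict Implicit.
Unset Printing Implicit Defensive.

Import Order.TTheory GRing.Theory Num.Theory.

Local Open Scope ring_scope.

(** * Abel's identity and the coefficients of the square root *)

Section Convolution.
Variable R : comPzRingType.

Lemma sum_nat_shift (i N : nat) (h : nat -> R) :
    (forall s, (N <= s)%N -> h s = 0) ->
  \sum_(0 <= j < N) h (i + j)%N = \sum_(0 <= s < N | (i <= s)%N) h s.
Proof.
move=> h0; have -> : \sum_(0 <= j < N) h (i + j)%N = \sum_(i <= s < N + i) h s.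
  rewrite -{2}[i]add0n big_addn addnK; apply: eq_bigr => j _.
  by rewrite addnC.
have [iN|Ni] := leqP i N.
  rewrite (@big_cat_nat _ _ _ N) //= ?leq_addr //.
  rewrite [X in _ + X]big1_seq ?addr0; last first.
    by move=> s; rewrite mem_index_iota => /andP[_ /andP[Ns _]]; exact: h0.
  rewrite [RHS](@big_cat_nat _ _ _ i) //= [X in _ = X + _]big1_seq ?add0r.
    by rewrite [RHS]big_nat_cond [LHS]big_nat_cond; apply: eq_bigl => s; lia.
  by move=> s; rewrite mem_index_iota; lia.
rewrite big1_seq; last first.
  by move=> s; rewrite mem_index_iota => /andP[_ /andP[? _]]; apply: h0; lia.
by rewrite big1_seq // => s; rewrite mem_index_iota; lia.
Qed.

(** Regrouping along the diagonals i + j = s. Since [G] vanishes from [N] on, the square of indices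
    reduces to a triangle, and truncated power series multiply like full ones. *)
Lemma sum_sum_conv (b b' G : nat -> R) (N : nat) :
    (forall s, (N <= s)%N -> G s = 0) ->
  \sum_(0 <= i < N) \sum_(0 <= j < N) b i * b' j * G (i + j)%N =
  \sum_(0 <= s < N) (\sum_(0 <= i < s.+1) b i * b' (s - i)%N) * G s.
Proof.
move=> G0.
have E i : \sum_(0 <= j < N) b i * b' j * G (i + j)%N =
    \sum_(0 <= s < N | (i <= s)%N) b i * b' (s - i)%N * G s.
  rewrite -(@sum_nat_shift i N (fun s => b i * b' (s - i)%N * G s)).
    by apply: eq_bigr => j _; rewrite addKn.
  by move=> s /G0 ->; rewrite mulr0.
under eq_bigr => i _ do rewrite E big_mkcond.
rewrite exchange_big_nat /= big_nat [RHS]big_nat.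
apply: eq_bigr => s /andP[_ sN].
rewrite mulr_suml -big_mkcond /= (@big_cat_nat _ _ _ s.+1) //=.
rewrite [X in _ + X]big1_seq ?addr0.
  by rewrite big_nat_cond [RHS]big_nat_cond; apply: eq_bigl => i; lia.
by move=> i; rewrite mem_index_iota; lia.
Qed.

End Convolution.

Section SqrtCoef.
Variable R : realFieldType.

(* The power series coefficients of sqrt (1 - z). *)
Definition sqrt_coef (j : nat) : R :=
  \prod_(0 <= i < j) (((2 * i)%:R - 1) / (2 * i.+1)%:R).

Lemma sqrt_coef0 : sqrt_coef 0 = 1. Proof. exact: big_geq. Qed.

Lemma sqrt_coefS j :
  (2 * j.+1)%:R * sqrt_coef j.+1 = sqrt_coef j * ((2 * j)%:R - 1).
Proof. by rewrite /sqrt_coef big_nat_recr //= mulrA mulrC divfK // pnatr_eq0. Qed.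

Lemma sqrt_coef_le0 j : sqrt_coef j.+1 <= 0.
Proof.
have S k : (sqrt_coef k.+1 <= 0) = (sqrt_coef k * ((2 * k)%:R - 1) <= 0).
  by rewrite -sqrt_coefS pmulr_rle0 // ltr0n.
elim: j => [|j IHj]; rewrite S.
  by rewrite sqrt_coef0 muln0 sub0r mulrN1 oppr_le0.
by rewrite mulr_le0_ge0 // subr_ge0 (ler_nat R 1) muln_gt0.
Qed.

(** The partial sums are the coefficients of sqrt (1 - z) / (1 - z) = (1 - z)^(-1/2), which is -2
    times the derivative of sqrt (1 - z). *)
Lemma sum_sqrt_coef N :
  \sum_(0 <= j < N.+1) sqrt_coef j = - (2 * N.+1)%:R * sqrt_coef N.+1.
Proof.
elim: N => [|N IHN].
  by rewrite big_nat1 mulNr sqrt_coefS sqrt_coef0 muln0 sub0r mulrN1 opprK.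
rewrite big_nat_recr //= IHN [in RHS]mulNr [in RHS]sqrt_coefS.
by rewrite natrM; ring.
Qed.

(** The coefficients after the first are nonpositive, while the partial sums start at 1 and stay
    nonnegative. *)
Lemma sum_norm_sqrt_coef N : \sum_(1 <= j < N.+1) `|sqrt_coef j| <= 1.
Proof.
have : 0 <= \sum_(0 <= j < N.+1) sqrt_coef j.
  by rewrite sum_sqrt_coef mulNr -mulrN mulr_ge0 // oppr_ge0 sqrt_coef_le0.
rewrite big_ltn //= sqrt_coef0 => S0.
suff -> : \sum_(1 <= j < N.+1) `|sqrt_coef j| =
    - \sum_(1 <= j < N.+1) sqrt_coef j by rewrite lerNl -subr_ge0 opprK addrC.
rewrite -sumrN big_nat [RHS]big_nat; apply: eq_bigr => -[//|j] _.
by rewrite ler0_norm // sqrt_coef_le0.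
Qed.

(* The differential equation (1 - z) B' = - B / 2 of the generating function B
   gives (1 - z) C' = - C for its square C. *)
Lemma sqrt_coef_conv s :
  \sum_(0 <= i < s.+1) sqrt_coef i * sqrt_coef (s - i) =
  (s == 0%N)%:R - (s == 1%N)%:R.
Proof.
pose c s := \sum_(0 <= i < s.+1) sqrt_coef i * sqrt_coef (s - i).
(* The coefficients of z B' B. The symmetry i -> s - i expresses them through [c], so the recurrence
   of [sqrt_coef] becomes one for [c]. *)
pose w s := \sum_(0 <= i < s.+1) i%:R * (sqrt_coef i * sqrt_coef (s - i)).
have wE n : 2 * w n = n%:R * c n.
  have -> : 2 * w n = w n + w n by ring.
  rewrite {2}/w big_nat_rev /= add0n -big_split /= mulr_sumr big_nat [RHS]big_nat.
  apply: eq_bigr => i /andP[_ iN].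
  rewrite subSS subKn // (mulrC (sqrt_coef (n - i))) -mulrDl -natrD.
  by rewrite subnKC.
have cS n : n.+1%:R * c n.+1 = (n%:R - 1) * c n.
  rewrite -wE {1}/w big_nat_recl // mul0r add0r.
  transitivity (2 * w n - c n); last by rewrite wE mulrBl mul1r.
  rewrite !mulr_sumr -sumrB; apply: eq_bigr => i _.
  rewrite subSS !mulrA -natrM sqrt_coefS natrM; ring.
have c0 : c 0%N = 1 by rewrite /c big_nat1 sqrt_coef0 mulr1.
rewrite -/(c s); case: s => [|[|s]]; first by rewrite c0 subr0.
  by have := cS 0%N; rewrite mul1r c0 mulr1.
(* The factor n - 1 in [cS] vanishes at n = 1, so c 2 = 0, and the recurrence carries the zero
   on. *)
rewrite subr0; elim: s => [|s IHs].
  by have /eqP := cS 1%N; rewrite subrr mul0r mulf_eq0 pnatr_eq0 => /eqP.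
by have /eqP := cS s.+2; rewrite IHs mulr0 mulf_eq0 pnatr_eq0 => /eqP.
Qed.

End SqrtCoef.

(** * Abel's binomial identity and the convolution identity for the volumes *)

Section Abel.
Variable R : realFieldType.
Implicit Types (c x y L : R).

Lemma exchange_triangle (n : nat) (F : nat -> nat -> R) :
  \sum_(0 <= k < n.+1) \sum_(0 <= j < (n - k).+1) F k j =
  \sum_(0 <= j < n.+1) \sum_(0 <= k < (n - j).+1) F k j.
Proof.
have E (G : nat -> R) k : (k < n.+1)%N ->
    \sum_(0 <= j < (n - k).+1) G j =
    \sum_(0 <= j < n.+1) if (k + j <= n)%N then G j else 0.
  move=> kn; rewrite -big_mkcond [RHS](@big_cat_nat _ _ _ (n - k).+1) //=; last lia.
  rewrite [X in _ = _ + X]big1_seq ?addr0.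
    by rewrite big_nat_cond [RHS]big_nat_cond; apply: eq_bigl => i; lia.
  by move=> i; rewrite mem_index_iota; lia.
rewrite big_nat; under eq_bigr => k /andP[_ kn] do rewrite (E _ _ kn).
rewrite -big_nat exchange_big_nat /= big_nat [RHS]big_nat.
apply: eq_bigr => j /andP[_ jn]; rewrite (E _ _ jn).
by apply: eq_bigr => k _; rewrite addnC.
Qed.

(** An n-th finite difference of step c of the m-th power. In the induction one factor x + c k is
    split: x keeps the order of the difference, and k C(n, k) = n C(n - 1, k - 1) turns c k into a
    difference of order n - 1. *)
Lemma binomial_difference m n c x : (m <= n)%N ->
  \sum_(0 <= k < n.+1) (-1) ^+ (n - k) * 'C(n, k)%:R * (x + c * k%:R) ^+ m =
  (m == n)%:R * (c ^+ n * n`!%:R).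
Proof.
elim: m n x => [|m IHm] n x mn.
  transitivity ((-1 + 1 : R) ^+ n).
    rewrite exprDn big_mkord; apply: eq_bigr => k _.
    by rewrite expr0 expr1n !mulr1 mulr_natr.
  rewrite addNr expr0n; case: n {mn} => [|n]; first by rewrite expr0 !mul1r.
  by rewrite mul0r.
case: n mn => [//|n mn].
transitivity (x * \sum_(0 <= k < n.+2)
    (-1) ^+ (n.+1 - k) * 'C(n.+1, k)%:R * (x + c * k%:R) ^+ m +
  c * n.+1%:R * \sum_(0 <= k < n.+1)
    (-1) ^+ (n - k) * 'C(n, k)%:R * (x + c + c * k%:R) ^+ m).
  transitivity (x * (\sum_(0 <= k < n.+2)
      (-1) ^+ (n.+1 - k) * 'C(n.+1, k)%:R * (x + c * k%:R) ^+ m) +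
    \sum_(0 <= k < n.+2)
      c * ((-1) ^+ (n.+1 - k) * (k * 'C(n.+1, k))%:R * (x + c * k%:R) ^+ m)).
    rewrite mulr_sumr -big_split /=; apply: eq_bigr => k _.
    by rewrite natrM exprS; ring.
  congr (_ + _); rewrite big_nat_recl // mul0n mulr0 mul0r mulr0 add0r.
  rewrite mulr_sumr; apply: eq_bigr => k _.
  have -> : x + c + c * k%:R = x + c * k.+1%:R by rewrite -natr1; ring.
  by rewrite subSS -mul_bin_diag natrM; ring.
rewrite !IHm //; last lia.
rewrite (_ : (m == n.+1) = false) ?mul0r ?mulr0 ?add0r; last lia.
by rewrite eqSS factS natrM exprS; ring.
Qed.

(** The coefficient of z^k in exp (x z). *)
Definition divpow (k : nat) x := x ^+ k / k`!%:R.

Lemma factr_neq0 k : k`!%:R != 0 :> R.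
Proof. by rewrite pnatr_eq0 -lt0n fact_gt0. Qed.

Lemma divpowD n x y :
  divpow n (x + y) = \sum_(0 <= k < n.+1) divpow k x * divpow (n - k) y.
Proof.
rewrite /divpow addrC exprDn mulr_suml big_mkord; apply: eq_bigr => k _.
have := bin_fact (leq_ord k); move/(congr1 (fun z => z%:R : R)); rewrite !natrM.
have := factr_neq0 k; have := factr_neq0 (n - k); have := factr_neq0 n.
rewrite -mulr_natr => n0 nk0 k0 nE.
by rewrite -nE; field; rewrite k0 nk0 /=; apply: contraNneq n0 => C0; rewrite -nE C0 mul0r.
Qed.

(** Write y - c k = (x + y) - (x + c k) and expand. The coefficient of each power of x + y is a
    finite difference of powers of x + c k whose degree equals its order, so only a power of c
    survives. *)
Lemma cauchy_abel n c x y :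
  \sum_(0 <= k < n.+1) divpow k (x + c * k%:R) * divpow (n - k) (y - c * k%:R) =
  \sum_(0 <= j < n.+1) c ^+ j * divpow (n - j) (x + y).
Proof.
transitivity (\sum_(0 <= k < n.+1) \sum_(0 <= j < (n - k).+1) divpow j (x + y) *
    (divpow k (x + c * k%:R) * divpow (n - j - k) (- (x + c * k%:R)))).
  apply: eq_bigr => k _.
  have -> : y - c * k%:R = x + y - (x + c * k%:R) by ring.
  rewrite [X in _ * X]divpowD mulr_sumr; apply: eq_bigr => j _.
  by rewrite subnAC; ring.
rewrite exchange_triangle big_nat_rev /= add0n.
rewrite big_nat [RHS]big_nat; apply: eq_bigr => j /andP[_ jn].
rewrite subSS -mulr_sumr mulrC subKn //; congr (_ * _).
apply: (mulIf (factr_neq0 j)).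
transitivity (\sum_(0 <= k < j.+1)
    (-1) ^+ (j - k) * 'C(j, k)%:R * (x + c * k%:R) ^+ j); last first.
  by rewrite binomial_difference // eqxx mul1r.
rewrite mulr_suml big_nat [RHS]big_nat; apply: eq_bigr => k /andP[_ kj].
have /bin_fact/(congr1 (fun z => z%:R : R)) : (k <= j)%N by [].
rewrite !natrM => <-; rewrite -[X in _ = _ * (_ ^+ X)](subnKC (kj : (k <= j)%N)) exprD.
rewrite /divpow [(- (x + _)) ^+ _]exprNn; field.
by rewrite !factr_neq0.
Qed.

(** The coefficient of z^m in z^j exp (x z); the test keeps the truncated [m - j] from giving 1 when
    j > m. *)
Definition ldivpow m j x := if (j <= m)%N then divpow (m - j) x else 0.

(** After k is shifted by i, this is [cauchy_abel] at n = m - (i + j), x = c i + c / 2 and y = L - c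
    i - c / 2; terms with k < i or k > m - j vanish. *)
Lemma cauchy_abel_shift m i j c L :
  \sum_(0 <= k < m.+1) ldivpow k i (c * k.+1%:R - c / 2) *
    ldivpow (m - k) j (L - c * k%:R - c / 2) =
  \sum_(0 <= l < m.+1) c ^+ l * ldivpow m (i + j + l) L.
Proof.
pose n := (m - (i + j))%N.
pose f k := divpow (k - i) (c * k.+1%:R - c / 2) *
    divpow (m - k - j) (L - c * k%:R - c / 2).
transitivity (\sum_(0 <= k < m.+1 | (i <= k)%N) if (k + j <= m)%N then f k else 0).
  rewrite [RHS]big_mkcond [LHS]big_nat [RHS]big_nat; apply: eq_bigr => k /andP[_ km].
  rewrite /ldivpow (_ : (j <= m - k)%N = (k + j <= m)%N); last lia.
  by case: ifP; case: ifP; rewrite ?mul0r ?mulr0.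
rewrite -(@sum_nat_shift _ i m.+1 (fun k => if (k + j <= m)%N then f k else 0)); last first.
  by move=> s ms; rewrite leqNgt (leq_trans ms) // leq_addr.
have [ijm|mij] := leqP (i + j) m; last first.
  rewrite !big1 // => k _; rewrite /ldivpow.
    by rewrite leqNgt (leq_trans mij) ?mulr0 // leq_addr.
  by rewrite leqNgt (leq_trans mij) //; lia.
have trunc (h h' : nat -> R) :
    (forall k, (k <= n)%N -> h k = h' k) -> (forall k, (n < k)%N -> h k = 0) ->
    \sum_(0 <= k < m.+1) h k = \sum_(0 <= k < n.+1) h' k.
  move=> hh' h0; rewrite (@big_cat_nat _ _ _ n.+1) //= ?ltnS ?leq_subr //.
  rewrite [X in _ + X]big1_seq ?addr0.
    by rewrite big_nat [RHS]big_nat; apply: eq_bigr => k /andP[_ kn]; exact: hh'.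
  by move=> k; rewrite mem_index_iota => /andP[_ /andP[nk _]]; exact: h0.
rewrite (trunc _ (fun k => divpow k (c * i%:R + c / 2 + c * k%:R) *
   divpow (n - k) (L - c * i%:R - c / 2 - c * k%:R))); last 2 first.
- move=> k kn; rewrite ifT; last by rewrite /n in kn; lia.
  rewrite /f addKn (_ : m - (i + k) - j = n - k)%N; last by rewrite /n; lia.
  by congr (divpow _ _ * divpow _ _); rewrite -?natr1 natrD; field.
- by move=> k nk; rewrite ifF //; rewrite /n in nk; lia.
rewrite cauchy_abel; symmetry; apply: trunc => k nk.
  rewrite /ldivpow ifT; last by rewrite /n in nk; lia.
  congr (_ * divpow _ _); last by ring.
  by rewrite /n; lia.
by rewrite /ldivpow ifF ?mulr0 //; rewrite /n in nk; lia.
Qed.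

(* The coefficient of z^m in sqrt (1 - c z) exp (z (L - c / 2)). *)
Definition sorted_volume c m L : R :=
  \sum_(0 <= j < m.+1) sqrt_coef R j * c ^+ j * divpow (m - j) (L - c / 2).

(** A range [N] independent of [m] allows sums over degrees and over coefficients to be
    exchanged. *)
Lemma sorted_volumeE c N m L : (m < N)%N ->
  sorted_volume c m L =
  \sum_(0 <= j < N) sqrt_coef R j * (c ^+ j * ldivpow m j (L - c / 2)).
Proof.
move=> mN; rewrite [RHS](@big_cat_nat _ _ _ m.+1) //= [X in _ + X]big1_seq ?addr0.
  rewrite /sorted_volume [LHS]big_nat [RHS]big_nat; apply: eq_bigr => j /andP[_ jm].
  by rewrite /ldivpow -ltnS jm mulrA.
move=> j; rewrite mem_index_iota /ldivpow => /andP[_ /andP[mj _]].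
by rewrite leqNgt mj !mulr0.
Qed.

(** The relation of [p_split], divided by m!, for the claimed values. The sum over k depends only on
    i + j by [cauchy_abel_shift]; the two square roots multiply to 1 - c z, which cancels the
    geometric series in c z and leaves exp (L z). *)
Lemma sorted_volume_conv c m L :
  \sum_(0 <= k < m.+1)
    sorted_volume c k (c * k.+1%:R) * sorted_volume c (m - k) (L - c * k%:R) =
  divpow m L.
Proof.
pose N := m.+1; pose b := sqrt_coef R.
pose F s := c ^+ s * ldivpow m s L.
have F0 s : (N <= s)%N -> F s = 0.
  by move=> ms; rewrite /F /ldivpow leqNgt ms mulr0.
transitivity (\sum_(0 <= i < N) \sum_(0 <= j < N) b i * b j *
    \sum_(0 <= l < N) F (i + j + l)%N).
  transitivity (\sum_(0 <= k < N) \sum_(0 <= i < N) \sum_(0 <= j < N)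
      b i * b j * (c ^+ (i + j) * (ldivpow k i (c * k.+1%:R - c / 2) *
      ldivpow (m - k) j (L - c * k%:R - c / 2)))).
    rewrite [LHS]big_nat [RHS]big_nat; apply: eq_bigr => k /andP[_ km].
    rewrite (@sorted_volumeE _ N) // (@sorted_volumeE _ N); last by rewrite /N; lia.
    rewrite mulr_suml; apply: eq_bigr => i _; rewrite mulr_sumr.
    by apply: eq_bigr => j _; rewrite -/b exprD; ring.
  rewrite exchange_big_nat; apply: eq_bigr => i _ /=.
  rewrite exchange_big_nat; apply: eq_bigr => j _ /=.
  rewrite -mulr_sumr -mulr_sumr cauchy_abel_shift mulr_sumr; congr (_ * _).
  by apply: eq_bigr => l _; rewrite /F mulrA -exprD.
rewrite (@sum_sum_conv _ b b (fun s => \sum_(0 <= l < N) F (s + l)%N)).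
  under eq_bigr => s _ do rewrite sqrt_coef_conv mulrBl.
  rewrite sumrB.
  have pick a : (a < N)%N -> \sum_(0 <= i < N) (i == a)%:R * (\sum_(0 <= l < N) F (i + l)%N)
     = \sum_(0 <= l < N) F (a + l)%N.
    move=> aN; rewrite (bigD1_seq a) ?iota_uniq ?mem_index_iota //= eqxx mul1r.
    by rewrite [X in _ + X]big1 ?addr0 // => i /negPf ->; rewrite mul0r.
  (* For m = 0 the index s = 1 of the term - c z lies outside the range. *)
  rewrite pick // /N; case: (posnP m) => [m0|m_gt0].
    rewrite m0 !big_nat1 !mul0r subr0 /F addn0 expr0 mul1r /ldivpow.
    by rewrite leq0n subn0 m0.
  (* The sum of [F] from 0 and the sum from 1 differ by [F 0], since [F m.+1] is 0. *)
  rewrite pick // big_nat_recl //= add0n.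
  under [X in _ - X]eq_bigr do rewrite add1n.
  rewrite [X in _ - X]big_nat_recr //= (F0 m.+1) // addr0.
  under eq_bigr do rewrite add0n.
  by rewrite addrK /F expr0 mul1r /ldivpow leq0n subn0.
by move=> s Ns; rewrite big1 // => l _; apply: F0; rewrite (leq_trans Ns) // leq_addr.
Qed.

End Abel.

(** * Subset sums and the minimizer decomposition *)

Section SortedRegion.
Variables (R : realFieldType) (I : finType) (c : R).
Implicit Types (A B J : {set I}) (a b : R) (x : I -> R).

Definition triangular (k : nat) : R := (k * k.+1)%:R / 2.

Lemma triangularD j k :
  triangular (j + k) = triangular j + triangular k + j%:R * k%:R.
Proof. by rewrite /triangular !natrM -!natr1 natrD; field. Qed.

Definition above J a b x :=
  [forall i in J, x i <= b] &&
  [forall A : {set I}, (A \subset J) ==>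
    (a * #|A|%:R + c * triangular #|A| <= \sum_(i in A) x i)].

(** The empty set is excluded because both sides are 0 there. *)
Definition above_strict J a b x :=
  [forall i in J, x i <= b] &&
  [forall A : {set I}, (A \subset J) && (A != set0) ==>
    (a * #|A|%:R + c * triangular #|A| < \sum_(i in A) x i)].

(** The second clause says that [J] is the strict minimizer of [excess a x] among its subsets (see
    [belowP]). Here [A] is the complement in [J] of the competing subset, the form that reflection
    turns into [above_strict]. *)
Definition below J a x :=
  [forall i in J, a <= x i] &&
  [forall A : {set I}, (A \subset J) && (A != set0) ==>
    (\sum_(i in A) x i <
     a * #|A|%:R + c * (#|A|%:R * #|J|.+1%:R - triangular #|A|))].

Definition excess a x A := \sum_(i in A) (x i - a) - c * triangular #|A|.

Lemma excessE a x A :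
  excess a x A = \sum_(i in A) x i - (a * #|A|%:R + c * triangular #|A|).
Proof. by rewrite /excess sumrB sumr_const -mulr_natr; ring. Qed.

Lemma excess_disjoint a x A B : [disjoint A & B] ->
  excess a x (A :|: B) =
  excess a x A + excess a x B - c * (#|A|%:R * #|B|%:R).
Proof.
move=> dAB; rewrite /excess (eq_bigl _ _ (fun i => in_setU i A B)) bigU //=.
rewrite cardsU disjoint_setI0 // cards0 subn0.
by rewrite triangularD; ring.
Qed.

(** By the cross term in [excess_disjoint], the two sides differ by c |A \ B| |B \ A|. *)
Lemma excess_submodular (c0 : 0 <= c) a x A B :
  excess a x (A :&: B) + excess a x (A :|: B) <= excess a x A + excess a x B.
Proof.
have dI : [disjoint A :&: B & A :\: B].
  by rewrite -setI_eq0; apply/eqP/setP => i; rewrite !inE; case: (i \in B); rewrite ?andbF.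
have dI' : [disjoint A :&: B & B :\: A].
  by rewrite -setI_eq0; apply/eqP/setP => i; rewrite !inE; case: (i \in A); rewrite ?andbF.
have dU : [disjoint A & B :\: A].
  by rewrite -setI_eq0; apply/eqP/setP => i; rewrite !inE; case: (i \in A).
have -> : A :|: B = A :|: (B :\: A).
  by apply/setP => i; rewrite !inE; case: (i \in A).
rewrite (excess_disjoint _ _ dU).
have BE : excess a x B = excess a x (A :&: B) + excess a x (B :\: A)
    - c * (#|A :&: B|%:R * #|B :\: A|%:R).
  by rewrite -excess_disjoint // setIC setID.
have : #|A :&: B|%:R <= #|A|%:R :> R by rewrite ler_nat subset_leq_card // subsetIl.
have q0 : 0 <= #|B :\: A|%:R :> R by [].
by move=> /(ler_wpM2r q0)/(ler_wpM2l c0); rewrite BE; lra.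
Qed.

Lemma belowP J a x :
  reflect ((forall i, i \in J -> a <= x i) /\
           (forall A, A \proper J -> excess a x J < excess a x A))
          (below J a x).
Proof.
have E A : A \subset J -> excess a x J < excess a x A =
    (\sum_(i in J :\: A) x i < a * #|J :\: A|%:R +
       c * (#|J :\: A|%:R * #|J|.+1%:R - triangular #|J :\: A|)).
  move=> AJ; have dA : [disjoint A & J :\: A].
    by rewrite -setI_eq0; apply/eqP/setP => i; rewrite !inE; case: (i \in A).
  have JE : J = A :|: (J :\: A).
    by apply/setP => i; rewrite !inE; have := subsetP AJ i; case: (i \in A) => // ->.
  have cJ : #|J|%:R = #|A|%:R + #|J :\: A|%:R :> R.
    by rewrite {1}JE cardsU disjoint_setI0 // cards0 subn0 natrD.
  rewrite {1}JE excess_disjoint // (excessE _ _ (J :\: A)) -natr1 cJ.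
  have -> : triangular #|J :\: A| = #|J :\: A|%:R * (#|J :\: A|%:R + 1) / 2.
    by rewrite /triangular natrM natr1.
  rewrite -subr_gt0 -[RHS]subr_gt0; by congr (0 < _); field.
apply: (iffP andP) => -[].
  move=> /forall_inP Ja /forallP JA; split=> // A /properP[AJ [i iJ iA]].
  rewrite E //; have /implyP := JA (J :\: A); apply; rewrite subsetDl /=.
  by apply/set0Pn; exists i; rewrite inE iA.
move=> Ja JA; split; first exact/forall_inP.
apply/forallP => A; apply/implyP => /andP[AJ /set0Pn[i iA]].
have := JA (J :\: A); rewrite E ?subsetDl // setDDr setDv set0U (setIidPr AJ); apply.
apply/properP; split; first exact: subsetDl.
by exists i; [apply: (subsetP AJ)|rewrite !inE iA].
Qed.

(** The cross term c |A| |B| of [excess (A :|: B)] is linear in |B|, so it only raises the level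
    from a to a + c |A|. *)
Lemma above_excessP J A a b x : [disjoint A & J] ->
  reflect ((forall i, i \in J -> x i <= b) /\
           (forall B, B \subset J -> excess a x A <= excess a x (A :|: B)))
          (above J (a + c * #|A|%:R) b x).
Proof.
move=> dAJ.
have E B : B \subset J -> excess a x A <= excess a x (A :|: B) =
    ((a + c * #|A|%:R) * #|B|%:R + c * triangular #|B| <= \sum_(i in B) x i).
  move=> BJ; rewrite excess_disjoint ?(disjointWr BJ) // (excessE _ _ B).
  by rewrite -subr_ge0 -[RHS]subr_ge0; congr (0 <= _); ring.
apply: (iffP andP) => -[].
  move=> /forall_inP Jb /forallP JB; split=> // B BJ; rewrite E //.
  by have /implyP := JB B; apply.
move=> Jb JB; split; first exact/forall_inP.
by apply/forallP => B; apply/implyP => BJ; rewrite -E // JB.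
Qed.

(* The witness A is the smallest minimizer of the submodular function
   [excess a x] among the subsets of J. *)
Lemma box_split J a b x (c0 : 0 <= c) (ab : a + c * #|J|%:R <= b) :
  (forall i, i \in J -> a <= x i <= b) <->
  exists2 A : {set I}, A \subset J &
    below A a x && above (J :\: A) (a + c * #|A|%:R) b x.
Proof.
have dD A : [disjoint A & J :\: A].
  by rewrite -setI_eq0; apply/eqP/setP => i; rewrite !inE; case: (i \in A).
split=> [xab|[A AJ /andP[]]].
  pose A0 := [arg min_(A < set0 | A \subset J) excess a x A]%O.
  have [A0J A0min] : A0 \subset J /\
      forall B, B \subset J -> excess a x A0 <= excess a x B.
    by rewrite /A0; case: Order.TotalTheory.arg_minP => [|A AJ Amin]; rewrite ?sub0set.
  pose P := [pred A : {set I} | (A \subset J) && (excess a x A <= excess a x A0)].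
  have PA0 : P A0 by rewrite /= A0J lexx.
  case: (arg_minnP (fun A : {set I} => #|A|) PA0) => A /andP[AJ AA0] Amin.
  have Ale B : B \subset J -> excess a x A <= excess a x B.
    by move=> /A0min; exact: le_trans.
  exists A => //; apply/andP; split.
    apply/belowP; split=> [i iA|B BA].
      by have /andP[] := xab i (subsetP AJ i iA).
    rewrite ltNge; apply/negP => BAx.
    have := Amin B; rewrite /= (subset_trans (proper_sub BA) AJ) /=.
    by rewrite (le_trans BAx AA0) => /(_ isT); rewrite leqNgt proper_card.
  apply/above_excessP => //; split=> [i|B BJ].
    by rewrite inE => /andP[_ /xab/andP[]].
  by apply: Ale; rewrite subUset AJ (subset_trans BJ) // subsetDl.
(* Conversely, singletons give the missing bounds: x i < a + c |A| <= b for i in A, and x i >= a + c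
   |A| + c >= a outside A. *)
move=> /andP[/forall_inP Aa /forallP AB] /andP[/forall_inP Jb /forallP JB] i iJ.
have sA (i0 : I) : \sum_(i in [set i0]) x i = x i0 by rewrite big_set1.
have tri1 : triangular 1 = 1 by rewrite /triangular mul1n divff ?pnatr_eq0.
have [iA|iA] := boolP (i \in A).
  rewrite Aa //=.
  have := AB [set i]; rewrite sub1set iA -card_gt0 cards1 /= sA tri1 -natr1 => /ltW xi.
  apply: le_trans ab; have : c * #|A|%:R <= c * #|J|%:R.
    by rewrite ler_wpM2l // ler_nat subset_leq_card.
  by move=> ?; apply: le_trans xi _; lra.
rewrite Jb ?inE ?iA // andbT.
have := JB [set i]; rewrite sub1set inE iA iJ cards1 /= sA tri1.
apply: le_trans; have : 0 <= c * #|A|%:R by rewrite mulr_ge0.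
lra.
Qed.

(** If B is not inside B', then B :&: B' is proper in B and has larger excess than B, while B :|: B'
    has at least the excess of B'. Adding the two contradicts submodularity. *)
Lemma box_split_uniq J A A' a b x (c0 : 0 <= c) :
  A \subset J -> A' \subset J ->
  below A a x -> above (J :\: A) (a + c * #|A|%:R) b x ->
  below A' a x -> above (J :\: A') (a + c * #|A'|%:R) b x -> A = A'.
Proof.
have dD B : [disjoint B & J :\: B].
  by rewrite -setI_eq0; apply/eqP/setP => i; rewrite !inE; case: (i \in B).
suff main (B B' : {set I}) : B \subset J -> B' \subset J ->
    below B a x -> above (J :\: B') (a + c * #|B'|%:R) b x -> B \subset B'.
  move=> AJ AJ' bA uA bA' uA'; apply/eqP; rewrite eqEsubset.
  by rewrite (main A A') // (main A' A).
move=> BJ BJ' /belowP[_ Bmin] /above_excessP-/(_ (dD _))[_ Bmax].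
apply/negPn/negP => BB'.
have /Bmin : B :&: B' \proper B.
  by rewrite properE subsetIl subsetI subxx.
have : B :\: B' \subset J :\: B' by rewrite setSD.
move=> /Bmax; rewrite (_ : B' :|: (B :\: B') = B :|: B'); last first.
  by apply/setP => i; rewrite !inE; case: (i \in B'); rewrite ?orbT ?orbF.
have := excess_submodular c0 a x B B'; lra.
Qed.

(** Substituting a + h - x i turns upper bounds on sums into lower bounds; this [h] makes the term c
    |A| (|J| + 1) cancel. *)
Lemma below_reflect J a x y :
  let h := a + c * #|J|.+1%:R in
  (forall i, i \in J -> y i = a + h - x i) ->
  below J a x = above_strict J a h y.
Proof.
move=> h yE; congr (_ && _).
  by apply: eq_forallb_in => i iJ; rewrite yE // /h; apply/idP/idP; lra.
apply: eq_forallb => A; have [/andP[AJ _]|//] := boolP (_ && _).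
rewrite /= [in RHS](eq_bigr (fun i => a + h - x i)); last first.
  by move=> i /(subsetP AJ); exact: yE.
rewrite sumrB sumr_const -mulr_natr -subr_gt0 -[RHS]subr_gt0; congr (0 < _).
by rewrite /h; ring.
Qed.

End SortedRegion.

(** * Sums of the smallest values as minima of subset sums *)

Section SortedSums.
Variables (R : realFieldType) (n : nat) (x : 'I_n -> R).

Let s := sort <=%R [seq x i | i <- enum 'I_n].

Lemma size_sort_values : size s = n.
Proof. by rewrite size_sort size_map size_enum_ord. Qed.

Lemma sort_values_perm : exists p : {perm 'I_n}, forall i : 'I_n, s`_i = x (p i).
Proof.
pose t := [tuple x i | i < n].
have sz : size s == n by rewrite size_sort_values.
have : perm_eq (Tuple sz) t by rewrite /= perm_sort.
move=> /tuple_permP[p pE]; exists p => i.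
have := congr1 (nth 0 ^~ i) pE => /= ->.
by rewrite (nth_map i) ?size_enum_ord // nth_ord_enum tnth_mktuple.
Qed.

Lemma nth_sort_values_le i j : (i <= j < n)%N -> s`_i <= s`_j.
Proof.
move=> /andP[ij jn]; apply: (sorted_leq_nth le_trans le_refl) => //.
- exact: (sort_sorted le_total).
- by rewrite inE size_sort_values (leq_ltn_trans ij).
- by rewrite inE size_sort_values.
Qed.

Lemma sum_nth_sort_values k : (k <= n)%N ->
  \sum_(0 <= i < k) s`_i = \sum_(i in [set i : 'I_n | (i < k)%N]) s`_i.
Proof.
move=> kn; rewrite big_mkord (big_ord_widen _ (fun i => s`_i) kn).
by apply: eq_bigl => i; rewrite inE.
Qed.

Lemma card_ord_lt k : (k <= n)%N -> #|[set i : 'I_n | (i < k)%N]| = k.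
Proof.
move=> kn; rewrite -sum1_card (eq_bigl (fun i : 'I_n => (i < k)%N)).
  by rewrite -(big_ord_widen _ (fun=> 1%N)) // sum1_card card_ord.
by move=> i; rewrite inE.
Qed.

Lemma sum_sort_values_le (A : {set 'I_n}) :
  \sum_(0 <= i < #|A|) s`_i <= \sum_(i in A) x i.
Proof.
have [p pE] := sort_values_perm.
have An : (#|A| <= n)%N by rewrite -[leqRHS]card_ord max_card.
pose B := p @^-1: A; pose K := [set i : 'I_n | (i < #|A|)%N].
have cB : #|B| = #|A| by rewrite card_preimset //; exact: perm_inj.
have -> : \sum_(i in A) x i = \sum_(i in B) s`_i.
  rewrite (reindex_inj (@perm_inj _ p)) /=.
  by apply: eq_big => [i|i _]; rewrite ?inE // pE.
rewrite sum_nth_sort_values // -/K.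
rewrite (big_setID B) [leRHS](big_setID K) /= setIC lerD2l.
(* After the common positions cancel, [K :\: B] and [B :\: K] have equal size, and [v] separates
   their values. *)
pose v := s`_#|A|.-1.
have cD : #|K :\: B| = #|B :\: K|.
  apply/eqP; rewrite -(eqn_add2l #|K :&: B|) cardsID setIC cardsID.
  by rewrite /K card_ord_lt // cB.
apply: (@le_trans _ _ (\sum_(i in K :\: B) v)).
  apply: ler_sum => i; rewrite !inE => /andP[_ iA].
  by apply: nth_sort_values_le; lia.
rewrite sumr_const cD -sumr_const; apply: ler_sum => i.
rewrite !inE -leqNgt => /andP[Ai _].
by apply: nth_sort_values_le; rewrite ltn_ord andbT (leq_trans _ Ai) // leq_pred.
Qed.

Lemma sum_sort_values_attained k : (k <= n)%N ->
  exists2 A : {set 'I_n}, #|A| = k & \sum_(i in A) x i = \sum_(0 <= i < k) s`_i.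
Proof.
move=> kn; have [p pE] := sort_values_perm.
pose K := [set i : 'I_n | (i < k)%N].
exists (p @: K); first by rewrite card_imset ?card_ord_lt //; exact: perm_inj.
rewrite big_imset /=; last by move=> i j _ _; exact: perm_inj.
by rewrite sum_nth_sort_values //; apply: eq_bigr => i _; rewrite pE.
Qed.

End SortedSums.

From mathcomp Require Import all_classical all_reals all_analysis.
From mathcomp Require Import measurable_realfun.

Import numFieldNormedType.Exports.

Local Open Scope classical_set_scope.
Local Open Scope ring_scope.

(** * The law of n independent uniform variables *)

Section Uniform01.
Variable R : realType.
Local Notation unif := (uniform_prob (@ltr01 R)).
Local Notation leb := (@lebesgue_measure R).

Lemma uniform01E (B : set R) : measurable B -> unif B = leb (B `&` `[0, 1]).
Proof.
move=> mB; rewrite /uniform_prob integral_uniform_pdf.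
rewrite (eq_integral (cst 1%E)).
  by rewrite integral_cst ?mul1e //; exact: measurableI.
move=> x; rewrite inE => -[_ /=]; rewrite in_itv /= /uniform_pdf => ->.
by rewrite subr0 invr1.
Qed.

Lemma uniform01_itv (a b : R) : 0 <= a -> a <= b -> b <= 1 ->
  unif `[a, b] = (b - a)%:E.
Proof.
move=> a0 ab b1; rewrite uniform01E // setIidl; last first.
  by apply: subset_itvScc; rewrite bnd_simp.
rewrite lebesgue_measure_itv /= lte_fin; move: ab; rewrite le_eqVlt.
by move=> /predU1P[->|->]; rewrite ?ltxx ?subrr -?EFinD.
Qed.

Lemma uniform01_set1 (a : R) : unif [set a] = 0%E.
Proof.
apply/eqP; rewrite uniform01E // eq_le measure_ge0 andbT.
rewrite -(lebesgue_measure_set1 a) le_measure ?inE //.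
exact: measurableI.
Qed.

Lemma lebesgue_measure_reflect (s : R) (A : set R) : measurable A ->
  leb ((fun x => s - x) @^-1` A) = leb A.
Proof.
move=> mA; have mf : measurable_fun setT (fun x : R => s - x).
  exact: measurable_funB.
pose f x : measurableTypeR R := s - x.
apply: esym; apply: (@lebesgue_measure_unique _ (pushforward leb f)) => //.
move=> _ [[a b]] _ <-.
(* The preimage of a half-open interval ]a, b] is closed on the other side; its length is the
   same. *)
transitivity (leb `[s - b, s - a[).
  rewrite [RHS]lebesgue_measure_itv /= [LHS]lebesgue_measure_itv /= !lte_fin.
  by rewrite ltrD2l ltrN2; case: ifP => // _; rewrite -!EFinD; congr (_%:E); ring.
congr (leb _); apply/seteqP; split=> x /=; rewrite /f !in_itv /=; lra.
Qed.

(** The identity outside [a, h], so that the whole uniform law on [0, 1] is preserved. *)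
Definition itv_reflect (a h x : R) : R := if a <= x <= h then a + h - x else x.

Lemma measurable_itv_reflect a h : measurable_fun setT (itv_reflect a h).
Proof.
apply: measurable_fun_ifT => //; last exact: measurable_funB.
by apply: measurable_and => //; exact: measurable_fun_ler.
Qed.

Lemma uniform01_reflect a h (B : set R) : 0 <= a -> h <= 1 -> measurable B ->
  unif (itv_reflect a h @^-1` B) = unif B.
Proof.
move=> a0 h1 mB; have mI := @measurable_itv R `[a, h].
have mrB : measurable (itv_reflect a h @^-1` B).
  by rewrite -[X in measurable X]setTI; exact: measurable_itv_reflect.
rewrite !uniform01E //.
have split_itv (C : set R) : measurable C -> leb C =
    (leb (C `&` `[a, h]) + leb (C `&` ~` `[a, h]))%E.
  move=> mC; rewrite -measureU; first by rewrite -setIUr setUv setIT.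
  - exact: measurableI.
  - by apply: measurableI => //; exact: measurableC.
  - by rewrite setIACA setICr setI0.
rewrite split_itv; last exact: measurableI.
rewrite [RHS]split_itv; last exact: measurableI.
congr (_ + _)%E.
  rewrite -(@lebesgue_measure_reflect (a + h) (B `&` `[0, 1] `&` `[a, h])).
    congr (leb _); apply/seteqP; split=> x /=; rewrite !in_itv /= /itv_reflect.
      move=> [[+ +] axh]; rewrite axh => ? ?; split; [split=> //|]; lra.
    move=> [[Bx ?] ?]; have axh : a <= x <= h by lra.
    rewrite axh; split; [split=> //|]; lra.
  by apply: measurableI => //; exact: measurableI.
congr (leb _); apply/seteqP; split=> x /=; rewrite !in_itv /= /itv_reflect;
  by move=> [[+ +] /negP/negbTE axh]; rewrite axh.
Qed.

End Uniform01.

(** * The uniform law on the cube, characterized by boxes *)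

Section UniformCube.
Variables (R : realType) (n : nat).
Local Notation unif := (uniform_prob (@ltr01 R)).

Definition box (B : 'I_n -> set R) : set (n.-tuple R) :=
  [set x | forall i, B i (tnth x i)].

Lemma measurable_box B : (forall i, measurable (B i)) -> measurable (box B).
Proof.
move=> mB; have -> : box B = \bigcap_(i in [set: 'I_n]) ((@tnth _ _ ^~ i) @^-1` B i).
  by apply/seteqP; split=> [x Bx i _|x Bx i]; exact: Bx.
apply: fin_bigcap_measurable => //= i _.
by rewrite -[X in measurable X]setTI; exact: (measurable_tnth i).
Qed.

Definition uniform_cube (mu : set (n.-tuple R) -> \bar R) :=
  forall B, (forall i, measurable (B i)) ->
    mu (box B) = (\prod_(i < n) unif (B i))%E.

(** Boxes are closed under intersection and generate the sigma-algebra of tuples. *)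
Lemma uniform_cube_unique (mu nu : probability (n.-tuple R) R) :
  uniform_cube mu -> uniform_cube nu ->
  forall A, measurable A -> mu A = nu A.
Proof.
move=> umu unu A mA.
pose G := [set box B | B in [set B : 'I_n -> set R | forall i, measurable (B i)]].
have boxT : box (fun=> setT) = setT by apply/seteqP; split.
apply: (g_sigma_algebra_measure_unique G _ (fun=> setT)) => //.
- by move=> _ [B mB <-]; exact: measurable_box.
- by move=> _; exists (fun=> setT).
- by rewrite bigcup_const.
- move=> _ _ [B mB <-] [B' mB' <-]; exists (fun i => B i `&` B' i).
    by move=> i; exact: measurableI.
  apply/seteqP; split=> x /=.
    by move=> BB; split=> i; have [] := BB i.
  by move=> [? ?] i; split.
- by move=> _ [B mB <-]; exact: etrans (umu B mB) (esym (unu B mB)).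
- by move=> _; rewrite (le_lt_trans (probability_le1 mu _)) ?ltry.
(* A generator constrains one coordinate, hence is a box with all other sides equal to [setT]. *)
move: A mA; apply: smallest_sub; first exact: smallest_sigma_algebra.
move=> A; rewrite -bigcup_seq /= => -[i _ [B mB <-]].
apply: sub_sigma_algebra; exists (fun j => if j == i then B else setT).
  by move=> j /=; case: ifP.
apply/seteqP; split=> [x Bx|x [_ Bx] j /=]; last by case: eqP => // ->.
by split=> //; have := Bx i; rewrite /= eqxx.
Qed.

Lemma uniform_cube_law d (T : measurableType d) (P : probability T R)
    (f : T -> n.-tuple R) (mu : probability (n.-tuple R) R) :
  measurable_fun setT f -> uniform_cube mu ->
  (forall B, (forall i, measurable (B i)) ->
    P (f @^-1` box B) = (\prod_(i < n) unif (B i))%E) ->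
  forall A, measurable A -> P (f @^-1` A) = mu A.
Proof.
move=> mf umu Pf A mA.
have PT : pushforward P f setT = 1%E.
  by rewrite /pushforward preimage_setT probability_setT.
pose F := isMeasurableFun.Build _ _ _ _ f mf.
pose X : {mfun T >-> n.-tuple R} := HB.pack f F.
exact: (@uniform_cube_unique (distribution P X) mu).
Qed.

Section Law.
Variable mu : probability (n.-tuple R) R.
Hypothesis mu_cube : uniform_cube mu.

Lemma uniform_cube_map (f : R -> R) : measurable_fun setT f ->
  (forall B, measurable B -> unif (f @^-1` B) = unif B) ->
  forall A, measurable A ->
    mu [set x | A [tuple f (tnth x i) | i < n]] = mu A.
Proof.
move=> mf fE; apply: uniform_cube_law => //.
  apply/measurable_fun_tnthP => i.
  rewrite [X in measurable_fun _ X](_ : _ = f \o (@tnth _ _ ^~ i)).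
    by apply: measurableT_comp => //; exact: measurable_tnth.
  by apply/funext => x /=; rewrite tnth_mktuple.
move=> B mB; rewrite -(eq_bigr _ (fun i _ => fE _ (mB i))) -mu_cube.
  by congr (mu _); apply/seteqP; split=> x Bx i; have := Bx i; rewrite /= tnth_mktuple.
by move=> i; rewrite -[X in measurable X]setTI; exact: mf.
Qed.

Definition mix (A : {set 'I_n}) (z : n.-tuple R * n.-tuple R) : n.-tuple R :=
  [tuple if i \in A then tnth z.1 i else tnth z.2 i | i < n].

Lemma measurable_mix A : measurable_fun setT (mix A).
Proof.
apply/measurable_fun_tnthP => i.
have -> : @tnth _ _ ^~ i \o mix A =
    (@tnth _ _ ^~ i) \o (fun z => if i \in A then z.1 else z.2).
  by apply/funext => z /=; rewrite tnth_mktuple; case: ifP.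
apply: measurableT_comp; first exact: measurable_tnth.
by case: (i \in A); [exact: measurable_fst|exact: measurable_snd].
Qed.

(* Resampling the coordinates outside A from an independent copy does not change
   the law; this turns independence of two groups of coordinates into a product
   measure. *)
Lemma uniform_cube_mix (A : {set 'I_n}) E : measurable E ->
  (mu \x mu)%E (mix A @^-1` E) = mu E.
Proof.
apply: uniform_cube_law => //; first exact: measurable_mix.
move=> B mB; pose B1 i := if i \in A then B i else setT.
pose B2 i := if i \in A then setT else B i.
have -> : mix A @^-1` box B = box B1 `*` box B2.
  apply/seteqP; split=> [z Bz|z [Bz1 Bz2] i].
    by split=> i; have := Bz i; rewrite /= tnth_mktuple /B1 /B2; case: ifP.
  have := Bz1 i; have := Bz2 i.
  by rewrite /= tnth_mktuple /B1 /B2; case: ifP.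
have mB1 i : measurable (B1 i) by rewrite /B1; case: ifP.
have mB2 i : measurable (B2 i) by rewrite /B2; case: ifP.
transitivity (mu (box B1) * mu (box B2))%E.
  by apply: product_measure1E; exact: measurable_box.
rewrite !mu_cube // -big_split /=; apply: eq_bigr => i _.
by rewrite /B1 /B2; case: ifP; rewrite probability_setT ?mule1 ?mul1e.
Qed.

(** Under [mix A] the first event depends on the first copy only and the second on the second copy,
    so the intersection pulls back to a rectangle. *)
Lemma uniform_cube_indep (A : {set 'I_n}) (E1 E2 : set (n.-tuple R)) :
  measurable E1 -> measurable E2 ->
  (forall x y, (forall i, i \in A -> tnth x i = tnth y i) -> E1 x -> E1 y) ->
  (forall x y, (forall i, i \notin A -> tnth x i = tnth y i) -> E2 x -> E2 y) ->
  mu (E1 `&` E2) = (mu E1 * mu E2)%E.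
Proof.
move=> mE1 mE2 E1A E2A.
rewrite -(@uniform_cube_mix A); last exact: measurableI.
rewrite -[RHS](@product_measure1E _ _ _ _ _ mu mu) //; congr (_ _).
apply/seteqP; split=> z [z1 z2]; split=> /=.
- by apply: E1A z1 => i iA; rewrite tnth_mktuple iA.
- by apply: E2A z2 => i /negbTE iA; rewrite tnth_mktuple iA.
- by apply: E1A z1 => i iA; rewrite tnth_mktuple iA.
- by apply: E2A z2 => i /negbTE iA; rewrite tnth_mktuple iA.
Qed.

Lemma measurable_sum_tnth (A : {set 'I_n}) :
  measurable_fun setT (fun x : n.-tuple R => \sum_(i in A) tnth x i).
Proof.
under [X in measurable_fun _ X]eq_fun do rewrite big_mkcond.
by apply: measurable_sum => i; case: (i \in A) => //; exact: measurable_tnth.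
Qed.

(** Resample one coordinate [i0] of A: given the others, the sum equals [s] for a single value of
    it, so every section is null. *)
Lemma uniform_cube_hyperplane (A : {set 'I_n}) (s : R) : A != finset.set0 ->
  mu [set x | \sum_(i in A) tnth x i = s] = 0%E.
Proof.
move=> /set0Pn[i0 i0A].
have mH : measurable [set x : n.-tuple R | \sum_(i in A) tnth x i = s].
  rewrite -[X in measurable X]setTI.
  exact: (measurable_sum_tnth A measurableT (measurable_set1 s)).
rewrite -(@uniform_cube_mix (~: [set i0])) //.
rewrite /product_measure1 integral0_eq // => x _ /=.
pose r := s - \sum_(i in A | i != i0) tnth x i.
pose B i := if i == i0 then [set r] else setT.
have mB i : measurable (B i) by rewrite /B; case: ifP.
apply/eqP; rewrite eq_le measure_ge0 andbT.
have -> : 0%E = mu (box B).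
  by rewrite mu_cube // (bigD1 i0) //= /B eqxx uniform01_set1 mul0e.
apply: le_measure; rewrite ?inE.
- by apply: measurable_xsection; rewrite -[X in measurable X]setTI; exact: measurable_mix.
- exact: measurable_box.
move=> y; rewrite /xsection /= inE /= => yE i; rewrite /B; case: eqP => // ->.
rewrite /= /r -yE (bigD1 i0) //= tnth_mktuple !inE eqxx /=.
rewrite [X in _ + X - _](eq_bigr (tnth x)) ?addrK // => j /andP[_ ji].
by rewrite tnth_mktuple !inE ji.
Qed.

Lemma uniform_cube_itv (J : {set 'I_n}) (a b : R) : 0 <= a -> a <= b -> b <= 1 ->
  mu [set x | forall i, i \in J -> a <= tnth x i <= b] = ((b - a) ^+ #|J|)%:E.
Proof.
move=> a0 ab b1; pose B i := if i \in J then `[a, b]%classic else setT.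
have -> : [set x : n.-tuple R | forall i, i \in J -> a <= tnth x i <= b] = box B.
  apply/seteqP; split=> x /= xab i.
    by rewrite /B; case: ifP => // iJ; rewrite set_itvcc; exact: xab.
  by move=> iJ; have := xab i; rewrite /B iJ set_itvcc.
rewrite mu_cube; last by move=> i; rewrite /B; case: ifP.
rewrite -prodr_const -prodEFin [RHS]big_mkcond; apply: eq_bigr => i _.
by rewrite /B; case: ifP => _; rewrite ?uniform01_itv ?probability_setT.
Qed.

End Law.
End UniformCube.

(** * The exact formula *)

Lemma sum_subsets_card (I : finType) (V : nmodType) (J : {set I}) (f : nat -> V) :
  \sum_(A : {set I} | A \subset J) f #|A| =
  \sum_(0 <= k < #|J|.+1) f k *+ 'C(#|J|, k).
Proof.
rewrite big_mkord (partition_big (fun A : {set I} => inord #|A| : 'I_#|J|.+1) predT) //=.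
apply: eq_bigr => k _.
rewrite -[in RHS]cards_draws -sumr_const; apply: eq_big => [A|A].
  rewrite !inE; apply: andb_id2l => AJ.
  by rewrite -val_eqE /= inordK // ltnS subset_leq_card.
by move=> /andP[AJ /eqP <-]; rewrite inordK // ltnS subset_leq_card.
Qed.

(** * Measurability of the regions *)

Section RegionMeasurable.
Variables (R : realType) (n : nat) (c : R).
Implicit Types (A J : {set 'I_n}) (a b : R).

Lemma measurable_forall d (T : measurableType d) (I : finType) (P : I -> T -> bool) :
  (forall i, measurable [set x | P i x]) -> measurable [set x | [forall i, P i x]].
Proof.
move=> mP; have -> : [set x | [forall i, P i x]] = \bigcap_(i in [set: I]) [set x | P i x].
  apply/seteqP; split=> x /=; first by move=> /forallP Px i _; exact: Px.
  by move=> Px; apply/forallP => i; exact: Px.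
by apply: fin_bigcap_measurable => // i _; exact: mP.
Qed.

Lemma measurable_implyb d (T : measurableType d) (p : bool) (P : T -> bool) :
  measurable [set x | P x] -> measurable [set x | p ==> P x].
Proof.
case: p => //= _; have -> : [set _ : T | true] = setT by apply/seteqP.
exact: measurableT.
Qed.

Lemma measurable_sum_ge A a :
  measurable [set x : n.-tuple R | a <= \sum_(i in A) tnth x i].
Proof.
rewrite -[X in measurable X]setTI.
have := measurable_sum_tnth A measurableT (@measurable_itv R `[a, +oo[).
by congr (measurable (_ `&` _)); apply/seteqP; split=> x /=; rewrite in_itv /= andbT.
Qed.

Lemma measurable_sum_gt A a :
  measurable [set x : n.-tuple R | a < \sum_(i in A) tnth x i].
Proof.
rewrite -[X in measurable X]setTI.
have := measurable_sum_tnth A measurableT (@measurable_itv R `]a, +oo[).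
by congr (measurable (_ `&` _)); apply/seteqP; split=> x /=; rewrite in_itv /= andbT.
Qed.

Lemma measurable_sum_lt A a :
  measurable [set x : n.-tuple R | \sum_(i in A) tnth x i < a].
Proof.
have := measurableC (measurable_sum_ge A a); congr (measurable _).
by apply/seteqP; split=> x /=; rewrite ltNge => /negP.
Qed.

Lemma measurable_tnth_le i b : measurable [set x : n.-tuple R | tnth x i <= b].
Proof.
have := measurableC (measurable_sum_gt [set i] b); congr (measurable _).
by apply/seteqP; split=> x /=; rewrite big_set1 leNgt => /negP.
Qed.

Lemma measurable_tnth_ge i a : measurable [set x : n.-tuple R | a <= tnth x i].
Proof.
have := measurable_sum_ge [set i] a; congr (measurable _).
by apply/seteqP; split=> x /=; rewrite big_set1.
Qed.

Lemma measurable_above J a b :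
  measurable [set x : n.-tuple R | above c J a b (tnth x)].
Proof.
have -> : [set x : n.-tuple R | above c J a b (tnth x)] =
    [set x | [forall i, (i \in J) ==> (tnth x i <= b)]] `&`
    [set x | [forall A : {set 'I_n}, (A \subset J) ==>
       (a * #|A|%:R + c * triangular R #|A| <= \sum_(i in A) tnth x i)]].
  by apply/seteqP; split=> x /=; [move/andP|move=> ?; apply/andP].
apply: measurableI; apply: measurable_forall => ?; apply: measurable_implyb.
  exact: measurable_tnth_le.
exact: measurable_sum_ge.
Qed.

Lemma measurable_above_strict J a b :
  measurable [set x : n.-tuple R | above_strict c J a b (tnth x)].
Proof.
have -> : [set x : n.-tuple R | above_strict c J a b (tnth x)] =
    [set x | [forall i, (i \in J) ==> (tnth x i <= b)]] `&`
    [set x | [forall A : {set 'I_n}, ((A \subset J) && (A != finset.set0)) ==>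
       (a * #|A|%:R + c * triangular R #|A| < \sum_(i in A) tnth x i)]].
  by apply/seteqP; split=> x /=; [move/andP|move=> ?; apply/andP].
apply: measurableI; apply: measurable_forall => ?; apply: measurable_implyb.
  exact: measurable_tnth_le.
exact: measurable_sum_gt.
Qed.

Lemma measurable_below J a :
  measurable [set x : n.-tuple R | below c J a (tnth x)].
Proof.
have -> : [set x : n.-tuple R | below c J a (tnth x)] =
    [set x | [forall i, (i \in J) ==> (a <= tnth x i)]] `&`
    [set x | [forall A : {set 'I_n}, ((A \subset J) && (A != finset.set0)) ==>
       (\sum_(i in A) tnth x i <
         a * #|A|%:R + c * (#|A|%:R * #|J|.+1%:R - triangular R #|A|))]].
  by apply/seteqP; split=> x /=; [move/andP|move=> ?; apply/andP].
apply: measurableI; apply: measurable_forall => ?; apply: measurable_implyb.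
  exact: measurable_tnth_ge.
exact: measurable_sum_lt.
Qed.

End RegionMeasurable.

Section ExactFormula.
Variables (R : realType) (n : nat) (mu : probability (n.-tuple R) R) (c : R).
Hypotheses (mu_cube : uniform_cube mu) (c0 : 0 <= c).
Implicit Types (A J : {set 'I_n}) (a b : R).

Let p_above J a b := fine (mu [set x | above c J a b (tnth x)]).
Let p_below J a := fine (mu [set x | below c J a (tnth x)]).

Lemma above_local J a b (x y : n.-tuple R) :
  (forall i, i \in J -> tnth x i = tnth y i) ->
  above c J a b (tnth x) -> above c J a b (tnth y).
Proof.
move=> xy /andP[/forall_inP xb /forallP xA]; apply/andP; split.
  by apply/forall_inP => i iJ; rewrite -xy // xb.
apply/forallP => A; apply/implyP => AJ; have := xA A; rewrite AJ /=.
by rewrite (eq_bigr (tnth y)) // => i /(fintype.subsetP AJ); exact: xy.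
Qed.

Lemma below_local J a (x y : n.-tuple R) :
  (forall i, i \in J -> tnth x i = tnth y i) ->
  below c J a (tnth x) -> below c J a (tnth y).
Proof.
move=> xy /andP[/forall_inP xb /forallP xA]; apply/andP; split.
  by apply/forall_inP => i iJ; rewrite -xy // xb.
apply/forallP => A; apply/implyP => AJ; have := xA A; rewrite AJ /=.
move: AJ => /andP[AJ _].
by rewrite (eq_bigr (tnth y)) // => i /(fintype.subsetP AJ); exact: xy.
Qed.

(** [box_split] and [box_split_uniq] partition the box; the two events in each piece concern
    disjoint groups of coordinates, hence are independent. *)
Lemma p_split J a b : 0 <= a -> a + c * #|J|%:R <= b -> b <= 1 ->
  (b - a) ^+ #|J| = \sum_(A : {set 'I_n} | A \subset J)
    p_below A a * p_above (J :\: A) (a + c * #|A|%:R) b.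
Proof.
move=> a0 ab b1.
have ab' : a <= b by apply: le_trans ab; rewrite lerDl mulr_ge0.
apply: EFin_inj; rewrite -(uniform_cube_itv mu_cube J a0 ab' b1) -sumEFin.
pose F A := [set x : n.-tuple R | below c A a (tnth x)] `&`
            [set x | above c (J :\: A) (a + c * #|A|%:R) b (tnth x)].
have -> : [set x : n.-tuple R | forall i, i \in J -> a <= tnth x i <= b] =
    \bigcup_(A in [set` [pred A : {set 'I_n} | A \subset J]]) F A.
  apply/seteqP; split=> x.
    by move=> /(box_split _ c0 ab)[A AJ /andP[? ?]]; exists A.
  by move=> [A /= AJ [? ?]]; apply/(box_split _ c0 ab); exists A => //; apply/andP.
rewrite measure_fin_bigcup //.
- rewrite -(@bigfs _ _ _ _ (index_enum {set 'I_n})) ?index_enum_uniq //=; last first.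
    by move=> A _; rewrite mem_index_enum.
  apply: eq_bigr => A AJ; rewrite (@uniform_cube_indep _ _ _ mu_cube A).
  + rewrite EFinM !fineK //; apply: fin_num_measure.
      exact: measurable_above.
    exact: measurable_below.
  + exact: measurable_below.
  + exact: measurable_above.
  + by move=> x y; exact: below_local.
  + move=> x y xy; apply: above_local => i; rewrite inE => /andP[iA _].
    exact: xy.
- move=> A A' AJ AJ' [x [[xA xA'] [yA yA']]].
  exact: (box_split_uniq c0 AJ AJ' xA xA' yA yA').
- move=> A _; apply: measurableI; [exact: measurable_below|exact: measurable_above].
Qed.

(** The two events differ only on finitely many hyperplanes, each of them null. *)
Lemma p_above_strict J a b :
  mu [set x | above_strict c J a b (tnth x)] =
  mu [set x | above c J a b (tnth x)].
Proof.
pose H A := [set x : n.-tuple R |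
  \sum_(i in A) tnth x i = a * #|A|%:R + c * triangular R #|A|].
have mH A : measurable (H A).
  rewrite -[X in measurable X]setTI.
  exact: (measurable_sum_tnth A measurableT (measurable_set1 _)).
pose N := \big[setU/set0]_(A : {set 'I_n} | A != finset.set0) H A.
have mN : measurable N by apply: bigsetU_measurable.
have N0 : mu.-negligible N.
  apply: big_ind => [||A A0]; [exact: negligible_set0|exact: negligibleU|].
  by apply/negligibleP => //; exact: uniform_cube_hyperplane.
have HN A : A != finset.set0 -> H A `<=` N.
  by move=> A0 x Hx; rewrite /N (bigD1 A) //=; left.
have -> : [set x | above c J a b (tnth x)] =
    [set x | above_strict c J a b (tnth x)] `|`
    ([set x | above c J a b (tnth x)] `&` N).
  apply/seteqP; split=> x /=.
    move=> xJ; have [xN|xN] := pselect (N x); [by right|left].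
    move: xJ => /andP[xb /forallP xJ]; apply/andP; split=> //.
    apply/forallP => A; apply/implyP => /andP[AJ A0].
    have := xJ A; rewrite AJ /= le_eqVlt => /predU1P[xA|//].
    by case: xN; apply: (HN A A0); rewrite /H /= xA.
  move=> [/andP[xb /forallP xJ]|[]//]; apply/andP; split=> //.
  apply/forallP => A; apply/implyP => AJ.
  have [->|A0] := eqVneq A finset.set0.
    by rewrite big_set0 cards0 /triangular mul0n mul0r !mulr0 addr0.
  by apply: ltW; have := xJ A; rewrite AJ A0.
have mA := @measurable_above _ n c J a b.
have mS := @measurable_above_strict _ n c J a b.
rewrite measureU0 //; first exact: measurableI.
by apply: measure_negligible; [exact: measurableI|apply: negligibleS N0; exact: subIsetr].
Qed.

(** Reflecting [a, h] preserves the law and exchanges [below] with [above_strict]. In both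
    directions the singleton conditions first put the coordinates of J into [a, h], where
    [itv_reflect] really reflects. *)
Lemma p_below_above J a : 0 <= a -> a + c * #|J|.+1%:R <= 1 ->
  p_below J a = p_above J a (a + c * #|J|.+1%:R).
Proof.
set h := a + _ => a0 h1; rewrite /p_below /p_above -p_above_strict; congr fine.
have ah : a <= h by rewrite lerDl mulr_ge0.
have mS := @measurable_above_strict _ n c J a h.
rewrite -(uniform_cube_map mu_cube (measurable_itv_reflect a h) _ mS); last first.
  by move=> B mB; exact: uniform01_reflect.
congr (mu _); apply/seteqP; split=> x /= xJ.
  rewrite -(@below_reflect _ _ _ _ _ (tnth x)) // => i iJ.
  rewrite tnth_mktuple /itv_reflect ifT //.
  move: xJ => /andP[/forall_inP xa /forallP xJ]; rewrite xa //=.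
  have := xJ [set i]%SET.
  rewrite finset.sub1set iJ -finset.card_gt0 cards1 /= finset.big_set1.
  rewrite /triangular mul1n divff ?pnatr_eq0 // mulr1 !mul1r => /ltW /le_trans; apply.
  by rewrite lerD2l ler_wpM2l // gerBl.
rewrite (@below_reflect _ _ _ _ _ _ (tnth [tuple itv_reflect a h (tnth x i) | i < n])) //.
move=> i iJ; rewrite tnth_mktuple /itv_reflect ifT //.
move: xJ => /andP[/forall_inP xa /forallP xJ].
have := xa i iJ; have := xJ [set i]%SET.
rewrite finset.sub1set iJ -finset.card_gt0 cards1 /= finset.big_set1.
rewrite /triangular mul1n divff ?pnatr_eq0 // !mulr1 tnth_mktuple => /ltW ax xh.
(* A coordinate outside [a, h] would be fixed, contradicting that its image lies in [a, h]. *)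
have {}ax : a <= itv_reflect a h (tnth x i) by apply: le_trans ax; rewrite lerDl.
move: ax xh; rewrite /itv_reflect; case: ifP => //; lra.
Qed.

Lemma p_above_set0 a b : p_above finset.set0 a b = 1.
Proof.
rewrite /p_above (_ : [set x | _] = setT) ?probability_setT //.
apply/seteqP; split=> x //= _; apply/andP; split.
  by apply/forall_inP => i; rewrite inE.
apply/forallP => A; apply/implyP; rewrite finset.subset0 => /eqP ->.
by rewrite big_set0 cards0 /triangular mul0n mul0r !mulr0 addr0.
Qed.

Lemma p_below_set0 a : p_below finset.set0 a = 1.
Proof.
rewrite /p_below (_ : [set x | _] = setT) ?probability_setT //.
apply/seteqP; split=> x //= _; apply/andP; split.
  by apply/forall_inP => i; rewrite inE.
by apply/forallP => A; apply/implyP; rewrite finset.subset0 => /andP[->].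
Qed.

Lemma sorted_volume0 L : sorted_volume c 0 L = 1.
Proof. by rewrite /sorted_volume big_nat1 sqrt_coef0 expr0 /divpow expr0 divr1 !mulr1. Qed.

(** Induction on |J|, comparing [p_split] with [sorted_volume_conv]. The terms with A neither empty
    nor J agree, which determines the sum of [p_above J] and [p_below J]; at the right end a + c
    (|J| + 1) these two are equal by reflection, which determines each. *)
Lemma p_aboveE J a b : 0 <= a -> a + c * #|J|.+1%:R <= b -> b <= 1 ->
  p_above J a b = (#|J|)`!%:R * sorted_volume c #|J| (b - a).
Proof.
move: {2}#|J|.+1 (ltnSn #|J|) => m; elim: m J a b => // m IHm J a b Jm a0 ab b1.
have [->|J0] := eqVneq J finset.set0.
  by rewrite p_above_set0 cards0 sorted_volume0 mulr1.
pose V k L := k`!%:R * sorted_volume c k L.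
(* The value expected of [p_below]: the reflected interval has length c (k + 1). *)
pose Q k := V k (c * k.+1%:R).
pose t L A := Q #|A| * V (#|J| - #|A|)%N (L - c * #|A|%:R).
have sum_t L : \sum_(A : {set 'I_n} | A \subset J) t L A = L ^+ #|J|.
  rewrite (sum_subsets_card _ (fun k => Q k * V (#|J| - k)%N (L - c * k%:R))).
  transitivity ((#|J|)`!%:R * divpow #|J| L); last first.
    by rewrite /divpow mulrC divfK // factr_neq0.
  rewrite -(sorted_volume_conv c) mulr_sumr big_nat [RHS]big_nat.
  apply: eq_bigr => k /andP[_ kJ].
  rewrite -(bin_fact (kJ : (k <= #|J|)%N)) /Q /V -mulr_natr !natrM; ring.
have splitJ (F : {set 'I_n} -> R) : \sum_(A : {set 'I_n} | A \subset J) F A =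
    F finset.set0 + (F J + \sum_(A : {set 'I_n} |
      (A \subset J) && (A != finset.set0) && (A != J)) F A).
  rewrite (bigD1 finset.set0) ?finset.sub0set //=; congr (_ + _).
  by rewrite (bigD1 J) //= fintype.subxx J0.
have sumE b' : a + c * #|J|.+1%:R <= b' -> b' <= 1 ->
    p_above J a b' + p_below J a = V #|J| (b' - a) + Q #|J|.
  move=> ab' b1'.
  have abJ : a + c * #|J|%:R <= b'.
    by apply: le_trans ab'; rewrite lerD2l ler_wpM2l // ler_nat.
  have := etrans (esym (p_split a0 abJ b1')) (esym (sum_t (b' - a))).
  rewrite !splitJ p_below_set0 mul1r finset.setD0 cards0 mulr0 addr0 finset.setDv.
  rewrite p_above_set0 mulr1 /t cards0 subn0 mulr0 subr0 subnn.
  have -> : Q 0%N = 1 by rewrite /Q /V fact0 mul1r sorted_volume0.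
  rewrite mul1r {2}/V fact0 mul1r sorted_volume0 mulr1 -/(V _ _).
  set S1 := \sum_(_ | _) _; set S2 := \sum_(_ | _) _.
  suff -> : S1 = S2 by lra.
  apply: eq_bigr => A /andP[/andP[AJ A0] AneJ].
  have cA : (#|A| < #|J|)%N by rewrite proper_card // finset.properEneq AneJ.
  have cD : #|J :\: A| = (#|J| - #|A|)%N by rewrite cardsD (finset.setIidPr AJ).
  (* This passes the length hypothesis on to J \ A at the level a + c |A|. *)
  have cJ : c * #|J|.+1%:R = c * #|A|%:R + c * (#|J| - #|A|).+1%:R.
    by rewrite -mulrDr -natrD addnS subnKC // ltnW.
  have cA1 : a + c * #|A|.+1%:R <= a + c * #|J|.+1%:R.
    by rewrite lerD2l ler_wpM2l // ler_nat ltnS ltnW.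
  have cA0 : 0 <= c * #|A|%:R by rewrite mulr_ge0.
  congr (_ * _).
    rewrite p_below_above //; last by lra.
    rewrite IHm //; [|by lia|by lra].
    by rewrite /Q /V; congr (_ * sorted_volume _ _ _); ring.
  rewrite IHm ?cD //; [|by rewrite -finset.card_gt0 in A0; lia|by lra|by lra].
  by rewrite /V; congr (_ * sorted_volume _ _ _); ring.
have h1 : a + c * #|J|.+1%:R <= 1 by apply: le_trans b1.
have qE : p_below J a = Q #|J|.
  have := sumE _ (lexx _) h1; rewrite -p_below_above //.
  by rewrite (_ : a + _ - a = c * #|J|.+1%:R) -/(Q _); [lra|ring].
have := sumE b ab b1; rewrite qE => /addIr; exact.
Qed.

End ExactFormula.

(** * The limit *)

Section Limits.
Variable R : realType.

Lemma cvg_finite_sum (f : nat -> nat -> R) (l : nat -> R) (J : nat) :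
  (forall j, (j < J)%N -> f n j @[n --> \oo] --> l j) ->
  \sum_(0 <= j < J) f n j @[n --> \oo] --> \sum_(0 <= j < J) l j.
Proof.
elim: J => [|J IHJ] fl.
  rewrite big_geq //; under eq_fun do rewrite big_geq //.
  exact: cvg_cst.
rewrite big_nat_recr //=; under eq_fun do rewrite big_nat_recr //=.
by apply: cvgD; [apply: IHJ => j jJ; apply: fl; exact: ltnW|exact: fl].
Qed.

(** Dominated convergence for series: cut at [J], where the tails of the series and of its absolute
    values are small. The finite head converges, and the rest is bounded uniformly in n since |r n
    j| <= 1. *)
Lemma tannery (a : nat -> R) (r : nat -> nat -> R) (l S M : R) :
  (forall N, \sum_(0 <= j < N) `|a j| <= M) ->
  (forall n j, `|r n j| <= 1) -> `|l| <= 1 ->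
  (forall j, r n j @[n --> \oo] --> l) ->
  \sum_(0 <= j < N) a j @[N --> \oo] --> S ->
  \sum_(0 <= j < n.+1) a j * r n j @[n --> \oo] --> S * l.
Proof.
move=> aM r1 l1 rl aS.
pose A N := \sum_(0 <= j < N) `|a j|.
have ndA : nondecreasing_seq A.
  apply/nondecreasing_seqP => N.
  by rewrite /A big_nat_recr //= lerDl.
have cA : cvgn A.
  by apply: nondecreasing_is_cvgn => //; exists M => _ [N _ <-]; exact: aM.
apply/cvgrPdist_le => e e0.
have e4 : 0 < e / 4 by rewrite divr_gt0.
have [J [AJ SJ]] : exists J, `|limn A - A J| <= e / 4 /\
    `|S - \sum_(0 <= j < J) a j| <= e / 4.
  have /cvgrPdist_le/(_ _ e4) HA : A @ \oo --> limn A by [].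
  have /cvgrPdist_le/(_ _ e4) HS := aS.
  have [J _ HJ] := filterI HA HS.
  by exists J; apply: HJ => /=.
have fin : \sum_(0 <= j < J) a j * r n j @[n --> \oo] --> (\sum_(0 <= j < J) a j) * l.
  rewrite mulr_suml; apply: cvg_finite_sum => j _.
  by apply: cvgMr; exact: rl.
move/cvgrPdist_le/(_ _ e4) : fin => fin.
near=> n.
have Jn : (J <= n.+1)%N.
  by apply: leqW; near: n; exact: nbhs_infty_ge.
have Xe : `|(\sum_(0 <= j < J) a j) * l - \sum_(0 <= j < J) a j * r n j| <= e / 4.
  by near: n.
rewrite (@big_cat_nat _ _ _ J) //=.
set X := \sum_(0 <= j < J) a j * r n j in Xe *; set Y := \sum_(J <= j < n.+1) _.
set SJ' := \sum_(0 <= j < J) a j in SJ Xe.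
have -> : S * l - (X + Y) = (S - SJ') * l + (SJ' * l - X) - Y by ring.
have Ye : `|Y| <= e / 4.
  apply: le_trans AJ; apply: le_trans (ler_norm _).
  apply: (@le_trans _ _ (A n.+1 - A J)); last first.
    by rewrite lerB //; exact: nondecreasing_cvgn_le.
  rewrite /A (@big_cat_nat _ _ _ J 0 n.+1) //= addrAC subrr add0r.
  apply: le_trans (ler_norm_sum _ _ _) _; apply: ler_sum => j _.
  by rewrite normrM ler_piMr.
have Se : `|(S - SJ') * l| <= e / 4.
  by rewrite normrM; apply: le_trans SJ; rewrite ler_piMr.
apply: le_trans (ler_normB _ _) _; apply: le_trans (lerD (ler_normD _ _) Ye) _.
lra.
Unshelve. all: by end_near. Qed.

Lemma sum_norm_sqrt_coef2 N : \sum_(0 <= j < N) `|sqrt_coef R j| <= 2.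
Proof.
case: N => [|N]; first by rewrite big_geq.
rewrite big_ltn // sqrt_coef0 normr1.
have -> : (2 : R) = 1 + 1 by ring.
by rewrite lerD2l sum_norm_sqrt_coef.
Qed.

(** Only products with i + j >= N separate the square from 1 - t. Each has a power of t at most t^N,
    and the absolute coefficients sum to at most 2 in either index. N >= 2 keeps both terms of 1 -
    t. *)
Lemma sum_sqrt_coef_sqr (t : R) (N : nat) : 0 <= t -> t <= 1 -> (2 <= N)%N ->
  `|(1 - t) - (\sum_(0 <= j < N) sqrt_coef R j * t ^+ j) ^+ 2| <= 4 * t ^+ N.
Proof.
move=> t0 t1 N2; pose b := sqrt_coef R.
pose G s : R := if (s < N)%N then t ^+ s else 0.
have GE : \sum_(0 <= i < N) \sum_(0 <= j < N) b i * b j * G (i + j)%N = 1 - t.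
  rewrite sum_sum_conv; last by move=> s Ns; rewrite /G ltnNge Ns.
  under eq_bigr => s _ do rewrite sqrt_coef_conv.
  case: N N2 @G => [|[|N]] // _ G.
  rewrite big_nat_recl // big_nat_recl //= big1 ?addr0; last first.
    by move=> i _; rewrite subr0 mul0r.
  by rewrite /G /= expr0 expr1; ring.
rewrite -GE expr2 mulr_suml -sumrB.
apply: le_trans (ler_norm_sum _ _ _) _.
apply: (@le_trans _ _ (\sum_(0 <= i < N) \sum_(0 <= j < N) `|b i| * `|b j| * t ^+ N)).
  apply: ler_sum => i _; rewrite mulr_sumr -sumrB.
  apply: le_trans (ler_norm_sum _ _ _) _; apply: ler_sum => j _.
  rewrite -/b (_ : _ - _ = b i * b j * (G (i + j)%N - t ^+ (i + j))); last first.
    by rewrite exprD; ring.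
  rewrite !normrM ler_wpM2l ?mulr_ge0 // /G.
  case: ltnP => [_|Nij]; first by rewrite subrr normr0 exprn_ge0.
  by rewrite sub0r normrN ger0_norm ?exprn_ge0 // ler_wiXn2l.
under eq_bigr => i _ do rewrite -mulr_suml -mulr_sumr.
rewrite -mulr_suml -mulr_suml ler_wpM2r ?exprn_ge0 //.
have -> : (4 : R) = 2 * 2 by rewrite -natrM.
by rewrite ler_pM ?sumr_ge0 // sum_norm_sqrt_coef2.
Qed.

(** The squares converge to 1 - t, and the partial sums are nonnegative, so they are the square
    roots of their squares. *)
Lemma cvg_sum_sqrt_coef (t : R) : 0 <= t -> t < 1 ->
  \sum_(0 <= j < N) sqrt_coef R j * t ^+ j @[N --> \oo] --> Num.sqrt (1 - t).
Proof.
move=> t0 t1; pose S N := \sum_(0 <= j < N) sqrt_coef R j * t ^+ j.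
have S0 N : 0 <= S N.
  case: N => [|N]; first by rewrite /S big_geq.
  rewrite /S big_ltn // sqrt_coef0 expr0 mulr1 -lerBlDl sub0r lerNl.
  apply: le_trans (sum_norm_sqrt_coef R N).
  rewrite -sumrN; apply: ler_sum => j _.
  apply: le_trans (ler_norm _) _; rewrite normrN normrM ler_piMr //.
  by rewrite ger0_norm ?exprn_ge0 // exprn_ile1 // ltW.
suff : S @ \oo --> Num.sqrt (1 - t) by [].
have -> : S = Num.sqrt \o (fun N => S N ^+ 2).
  by apply/funext => N /=; rewrite sqrtr_sqr ger0_norm.
apply: continuous_cvg; first exact: sqrt_continuous.
apply/cvgrPdist_le => e e0.
have : 4 * t ^+ N @[N --> \oo] --> (4 * 0 : R).
  by apply: cvgMr; apply: cvg_expr; rewrite ger0_norm.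
rewrite mulr0 => /cvgrPdist_le/(_ _ e0) te.
near=> N.
apply: le_trans (@sum_sqrt_coef_sqr t N t0 (ltW t1) _) _.
  by near: N; exact: nbhs_infty_ge.
rewrite -[leLHS]ger0_norm ?mulr_ge0 ?exprn_ge0 // -normrN -sub0r.
by near: N.
Unshelve. all: by end_near. Qed.

Lemma cvg_natr_div2 (t : R) : t / n%:R / 2 @[n --> \oo] --> (0 : R).
Proof.
have : harmonic n * (t / 2) @[n --> \oo] --> (0 * (t / 2) : R).
  by apply: cvgMr_tmp; exact: cvg_harmonic.
rewrite mul0r => ht; rewrite -(cvg_shiftS (fun n => t / n%:R / 2)).
apply: cvg_trans ht; apply: near_eq_cvg; apply: nearW => n.
by rewrite /harmonic /=; ring.
Qed.

(** With s = t / (2 n), squeeze by exp (- s / (1 - s)) <= 1 - s <= exp (- s), raised to the power n;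
    the lower bound is 1 + y <= exp y at y = s / (1 - s). *)
Lemma cvg_expr_div (t : R) : 0 <= t -> t <= 1 ->
  (1 - t / n%:R / 2) ^+ n @[n --> \oo] --> expR (- t / 2).
Proof.
move=> t0 t1.
have s0 := cvg_natr_div2 t.
have lower : expR (- (t / 2) / (1 - t / n%:R / 2)) @[n --> \oo] --> expR (- t / 2).
  apply: continuous_cvg; first exact: continuous_expR.
  rewrite [X in _ --> X](_ : _ = - (t / 2) * (1 - 0)^-1); last by field.
  apply: cvgMl_tmp; apply: cvgV; first by rewrite subr0 oner_eq0.
  by apply: cvgB; [exact: cvg_cst|].
apply: (squeeze_cvgr _ lower (cvg_cst (expR (- t / 2)))).
near=> n.
have n0 : (0 < n)%N by near: n; exact: nbhs_infty_gt.
have nR : n%:R != 0 :> R by rewrite pnatr_eq0 -lt0n.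
set s := t / n%:R / 2.
have sn : s * n%:R = t / 2 by rewrite /s; field.
have sge : 0 <= s by rewrite !mulr_ge0 ?invr_ge0.
have sle : s <= 1 / 2.
  rewrite ler_wpM2r ?invr_ge0 // ler_pdivrMr ?ltr0n // mul1r.
  by apply: le_trans t1 _; rewrite (ler_nat R 1).
apply/andP; split.
  rewrite (_ : - (t / 2) / (1 - s) = - (s / (1 - s)) * n%:R); last first.
    by rewrite -sn; ring.
  rewrite expRM_natr; apply: lerXn2r; rewrite ?nnegrE ?expR_ge0 //; first by lra.
  have s1 : 0 < 1 - s by lra.
  rewrite expRN -[leRHS]invrK lef_pV2 ?posrE ?expR_gt0 ?invr_gt0 //.
  rewrite [leLHS](_ : _ = 1 + s / (1 - s)) ?expR_ge1Dx //.
  by field; rewrite gt_eqF.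
rewrite (_ : - t / 2 = - s * n%:R); last by rewrite !mulNr sn.
by rewrite expRM_natr; apply: lerXn2r; rewrite ?nnegrE ?expR_ge0 ?expR_ge1Dx //; lra.
Unshelve. all: by end_near. Qed.

Lemma cvg_sorted_volume (t : R) : 0 <= t -> t < 1 ->
  n`!%:R * sorted_volume (t / n%:R) n 1 @[n --> \oo] -->
    Num.sqrt (1 - t) * expR (- t / 2).
Proof.
move=> t0 t1.
pose u n : R := 1 - t / n%:R / 2.
(* For j <= n this is n! / ((n - j)! n^j), so the quantity is the sum of sqrt_coef j t^j r n j, as
   in [tannery]. *)
pose q n j : R := \prod_(0 <= i < j) ((n - i)%:R / n%:R).
pose r n j : R := if (j <= n)%N then q n j * u n ^+ (n - j) else 0.
(* At n = 0 the quotient t / n is 0, so the bound holds for every n. *)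
have u01 n : 0 < u n <= 1.
  have : 0 <= t / n%:R by rewrite mulr_ge0 ?invr_ge0.
  have : t / n%:R <= 1.
    case: n => [|n]; first by rewrite invr0 mulr0.
    rewrite ler_pdivrMr ?ltr0n // mul1r; apply: le_trans (ltW t1) _.
    by rewrite (ler_nat R 1).
  by rewrite /u; lra.
have q01 n j : 0 <= q n j <= 1.
  rewrite /q; apply: (big_ind (fun x => 0 <= x <= 1)) => [|x y|i _].
  - by rewrite ler01 lexx.
  - by move=> /andP[? ?] /andP[? ?]; rewrite mulr_ge0 ?mulr_ile1.
  - rewrite mulr_ge0 ?invr_ge0 //=; case: n => [|n]; first by rewrite invr0 mulr0.
    by rewrite ler_pdivrMr ?ltr0n // mul1r ler_nat leq_subr.
have r01 n j : `|r n j| <= 1.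
  rewrite /r; case: ifP => _; last by rewrite normr0.
  have /andP[? ?] := q01 n j; have /andP[/ltW ? ?] := u01 n.
  by rewrite ger0_norm ?mulr_ge0 ?exprn_ge0 // mulr_ile1 ?exprn_ge0 ?exprn_ile1.
have c1 j : (fun n => (n - j)%:R / n%:R : R) @ \oo --> (1 : R).
  rewrite -(cvg_shiftS (fun n => (n - j)%:R / n%:R : R)).
  have : 1 - j%:R * harmonic n @[n --> \oo] --> (1 - j%:R * 0 : R).
    by apply: cvgB; [exact: cvg_cst|apply: cvgMl_tmp; exact: cvg_harmonic].
  rewrite mulr0 subr0; apply: cvg_trans; apply: near_eq_cvg.
  near=> n; have jn : (j <= n.+1)%N by apply: leqW; near: n; exact: nbhs_infty_ge.
  by rewrite /harmonic /= natrB //; field; rewrite addrC natr1 pnatr_eq0.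
have u1 : u n @[n --> \oo] --> (1 : R).
  rewrite -[1]subr0; apply: cvgB; [exact: cvg_cst|exact: cvg_natr_div2].
have qS n j : q n j.+1 = q n j * ((n - j)%:R / n%:R) by rewrite /q big_nat_recr.
have q1 j : q n j @[n --> \oo] --> (1 : R).
  elim: j => [|j IHj].
    rewrite /q; under eq_fun do rewrite big_geq //.
    exact: cvg_cst.
  under eq_fun do rewrite qS.
  have := cvgM IHj (c1 j); rewrite mulr1; exact.
have uX1 j : u n ^+ j @[n --> \oo] --> (1 : R).
  elim: j => [|j IHj].
    under eq_fun do rewrite expr0.
    exact: cvg_cst.
  under eq_fun do rewrite exprS.
  have := cvgM u1 IHj; rewrite mulr1; exact.
have u_neq0 n : u n != 0 by have /andP[/lt0r_neq0] := u01 n.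
have rl j : r n j @[n --> \oo] --> expR (- t / 2).
  have : q n j * (u n ^+ n * (u n ^+ j)^-1) @[n --> \oo] -->
      1 * (expR (- t / 2) * 1^-1).
    apply: cvgM => //; apply: cvgM; first exact: cvg_expr_div t0 (ltW t1).
    by apply: cvgV; rewrite ?oner_eq0.
  rewrite invr1 mulr1 mul1r; apply: cvg_trans; apply: near_eq_cvg.
  near=> n; have jn : (j <= n)%N by near: n; exact: nbhs_infty_ge.
  have -> : u n ^+ n = u n ^+ (n - j) * u n ^+ j by rewrite -exprD subnK.
  by rewrite /r jn mulfK // expf_neq0.
have aM N : \sum_(0 <= j < N) `|sqrt_coef R j * t ^+ j| <= 2.
  apply: le_trans (sum_norm_sqrt_coef2 N); apply: ler_sum => j _.
  by rewrite normrM ler_piMr // ger0_norm ?exprn_ge0 // exprn_ile1 // ltW.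
have l1 : `|expR (- t / 2)| <= 1.
  by rewrite ger0_norm ?expR_ge0 // expR_le1; lra.
have := tannery aM r01 l1 rl (cvg_sum_sqrt_coef t0 t1).
apply: cvg_trans; apply: near_eq_cvg.
near=> n; have n0 : (0 < n)%N by near: n; exact: nbhs_infty_gt.
have nR : n%:R != 0 :> R by rewrite pnatr_eq0 -lt0n.
have qE j : (j <= n)%N -> n`!%:R = q n j * n%:R ^+ j * (n - j)`!%:R.
  elim: j => [|j IHj] jn; first by rewrite /q big_geq // expr0 !mul1r subn0.
  rewrite IHj ?(ltnW jn) // qS exprS -(subnSK jn) factS natrM.
  by field.
rewrite /sorted_volume mulr_sumr big_nat [RHS]big_nat; apply: eq_bigr => j /andP[_ jn].
rewrite /r (jn : (j <= n)%N) (qE j) // /divpow /u expr_div_n.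
by field; rewrite expf_neq0 // factr_neq0.
Unshelve. all: by end_near. Qed.

End Limits.

(** * From the minimum of scaled sums to all subset sums *)

Lemma le_bigmin_seq (R : realType) (s : seq nat) (F : nat -> R) (x t : R) :
  (t <= \big[Num.min/x]_(k <- s) F k) = (t <= x) && all (fun k => t <= F k) s.
Proof.
elim: s => [|k s IHs]; first by rewrite big_nil andbT.
by rewrite big_cons le_min IHs /= andbCA.
Qed.

Lemma scaled_partial_sum_ge (R : realType) (T : Type) (n : nat)
    (X : 'I_n -> T -> R) (k : nat) (w : T) (t : R) : (0 < n)%N -> (0 < k)%N ->
  (t <= scaled_partial_sum X k w) =
  (t / n%:R * triangular R k <=
     \sum_(0 <= i < k) (sort <=%R [seq X i w | i <- enum 'I_n])`_i).
Proof.
move=> n0 k0; rewrite /scaled_partial_sum big_add1 /=.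
set S := \sum_(0 <= i < k) _.
have nR : 0 < n%:R :> R by rewrite ltr0n.
have kR : 0 < (k * k.+1)%:R :> R by rewrite ltr0n muln_gt0 k0.
have cR : 0 < (2 * n)%:R / (k * k.+1)%:R :> R.
  by rewrite divr_gt0 // ltr0n muln_gt0.
rewrite -(ler_pM2l cR (_ * _) S); congr (_ <= _).
rewrite /triangular natrM; field.
by rewrite addrC natr1 !pnatr_eq0 -!lt0n n0 k0.
Qed.

Lemma min_scaled_partial_sum_ge (R : realType) (T : Type) (n : nat)
    (X : 'I_n -> T -> R) (w : T) (t : R) : (0 < n)%N ->
  (t <= min_scaled_partial_sum X w) =
  [forall A : {set 'I_n},
    t / n%:R * triangular R #|A| <= \sum_(i in A) X i w].
Proof.
move=> n0; rewrite /min_scaled_partial_sum le_bigmin_seq.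
apply/andP/forallP => [[_ /allP tX] A|tX].
  have [->|A0] := eqVneq A finset.set0.
    by rewrite big_set0 cards0 /triangular mul0n mul0r mulr0.
  have An : (#|A| <= n)%N by rewrite -[leqRHS]card_ord max_card.
  apply: le_trans (sum_sort_values_le (fun i => X i w) A).
  rewrite -scaled_partial_sum_ge //; last by rewrite finset.card_gt0.
  by apply: tX; rewrite mem_index_iota finset.card_gt0 A0.
have tk k : (0 < k <= n)%N -> t <= scaled_partial_sum X k w.
  move=> /andP[k0 kn]; rewrite scaled_partial_sum_ge //.
  have [A <- <-] := sum_sort_values_attained (fun i => X i w) kn.
  exact: tX.
(* The neutral element of the minimum is the term k = 1, in range since n > 0. *)
split; first exact: tk.
by apply/allP => k; rewrite mem_index_iota; exact: tk.
Qed.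

(** * The sample as a random point of the cube *)

Section Sample.
Variables (R : realType) (d : measure_display) (T : measurableType d).
Variables (P : probability T R) (n : nat) (U : 'I_n -> {RV P >-> R}).
Hypotheses (Uindep : mutually_independent U) (Uunif : forall i, uniform01 (U i)).

Definition sample (w : T) : n.-tuple R := [tuple U i w | i < n].

Lemma measurable_sample : measurable_fun setT sample.
Proof.
apply/measurable_fun_tnthP => i.
rewrite [X in measurable_fun _ X](_ : _ = (U i : T -> R)); first exact: measurable_funPT.
by apply/funext => w /=; rewrite tnth_mktuple.
Qed.

HB.instance Definition _ := isMeasurableFun.Build _ _ _ _ sample measurable_sample.

Lemma uniform_cube_sample : uniform_cube (distribution P sample).
Proof.
move=> B mB; rewrite /distribution /pushforward.
have -> : sample @^-1` box B = \bigcap_(i in [set` [set: 'I_n]%SET]) (U i @^-1` B i).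
  apply/seteqP; split=> w Bw i.
    by move=> _; have := Bw i; rewrite /= tnth_mktuple.
  by rewrite /= tnth_mktuple; apply: Bw; rewrite /= finset.in_setT.
rewrite Uindep; last by move=> i _; exact: mB.
apply: eq_big => [i|i _]; first by rewrite finset.in_setT.
exact: Uunif.
Qed.

Lemma min_event_preimage (t : R) : (0 < n)%N ->
  [set w | t <= min_scaled_partial_sum U w] =
  sample @^-1` [set x | [forall A : {set 'I_n},
    t / n%:R * triangular R #|A| <= \sum_(i in A) tnth x i]].
Proof.
move=> n0; apply/seteqP; split=> w; rewrite /= min_scaled_partial_sum_ge //.
  by move=> /forallP tw; apply/forallP => A; under eq_bigr do rewrite tnth_mktuple.
move=> /forallP tw; apply/forallP => A; have := tw A.
by under eq_bigr do rewrite tnth_mktuple.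
Qed.

Lemma measurable_min_event (t : R) : (0 < n)%N ->
  measurable [set w | t <= min_scaled_partial_sum U w].
Proof.
move=> n0; rewrite min_event_preimage // -[X in measurable X]setTI.
apply: measurable_sample => //; apply: measurable_forall => A.
exact: measurable_sum_ge.
Qed.

(** The event [above] also asks for coordinates at most 1, which holds outside the null complement
    of the unit cube. *)
Lemma uniform_cube_above (mu : probability (n.-tuple R) R) (c : R) :
  uniform_cube mu ->
  mu [set x | [forall A : {set 'I_n}, c * triangular R #|A| <= \sum_(i in A) tnth x i]]
  = mu [set x | above c [set: 'I_n]%SET 0 1 (tnth x)].
Proof.
move=> umu; set E := [set x | _].
have mE : measurable E by apply: measurable_forall => A; exact: measurable_sum_ge.
pose B := [set x : n.-tuple R | forall i, i \in [set: 'I_n]%SET -> 0 <= tnth x i <= 1].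
have mB : measurable B.
  have -> : B = box (fun=> `[0, 1]%classic).
    by apply/seteqP; split=> x Bx i; have := Bx i; rewrite /= in_itv finset.in_setT;
      [apply|].
  exact: measurable_box.
have B1 : mu (~` B) = 0%E.
  rewrite probability_setC // uniform_cube_itv // ?ler01 //.
  by rewrite subr0 expr1n subee.
have mA := @measurable_above R n c [set: 'I_n]%SET 0 1.
apply/eqP; rewrite eq_le; apply/andP; split.
  rewrite -(@measureU0 _ _ _ mu _ (~` B) mA _ B1); last exact: measurableC.
  apply: le_measure; rewrite ?inE //; first by apply: measurableU => //; exact: measurableC.
  move=> x Ex; have [Bx|Bx] := pselect (B x); [left|by right].
  apply/andP; split; first by apply/forall_inP => i iT; have /andP[] := Bx i iT.
  apply/forallP => A; rewrite mul0r add0r finset.subsetT.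
  by move/forallP : Ex; apply.
apply: le_measure; rewrite ?inE // => x /andP[_ /forallP xA].
by apply/forallP => A; have := xA A; rewrite mul0r add0r finset.subsetT.
Qed.

(** The last hypothesis is the length condition of [p_aboveE] for a = 0, b = 1 and c = t / n. *)
Lemma prob_min_ge (t : R) : (0 < n)%N -> 0 <= t -> t / n%:R * n.+1%:R <= 1 ->
  P [set w | t <= min_scaled_partial_sum U w] =
  (n`!%:R * sorted_volume (t / n%:R) n 1)%:E.
Proof.
move=> n0 t0 tn; rewrite min_event_preimage //.
transitivity (distribution P sample [set x | above (t / n%:R) [set: 'I_n]%SET 0 1 (tnth x)]).
  exact: (uniform_cube_above _ uniform_cube_sample).
have := @p_aboveE R n (distribution P sample) (t / n%:R) uniform_cube_sample _
  [set: 'I_n]%SET 0 1.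
rewrite cardsT card_ord add0r subr0 => <- //; last by rewrite divr_ge0.
by rewrite fineK // fin_num_measure //; exact: measurable_above.
Qed.

End Sample.

Unset Implicit Arguments.

Theorem mainTheorem2 (R : realType) (d : nat -> measure_display)
    (T : forall n : nat, measurableType (d n))
    (P : forall n : nat, probability (T n) R)
    (U : forall n : nat, 'I_n -> {RV (P n) >-> R})
    (Uindep : forall n : nat, (1 <= n)%N -> mutually_independent (U n))
    (Uunif : forall n : nat, (1 <= n)%N -> forall i : 'I_n, uniform01 (U n i))
    (t : R) (t0 : 0 <= t) (t1 : t <= 1) :
  P n [set w | t <= min_scaled_partial_sum (U n) w] @[n --> \oo] -->
    (Num.sqrt (1 - t) * expR (- t / 2))%:E.
Proof.
have fin s n : (0 < n)%N ->
    P n [set w | s <= min_scaled_partial_sum (U n) w] \is a fin_num.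
  by move=> n0; apply: fin_num_measure; exact: measurable_min_event.
have lt1 s : 0 <= s -> s < 1 ->
    fine (P n [set w | s <= min_scaled_partial_sum (U n) w]) @[n --> \oo] -->
      Num.sqrt (1 - s) * expR (- s / 2).
  move=> s0 s1; have := cvg_sorted_volume s0 s1.
  apply: cvg_trans; apply: near_eq_cvg.
  near=> n; have n0 : (0 < n)%N by near: n; exact: nbhs_infty_gt.
  rewrite (prob_min_ge (Uindep n n0) (Uunif n n0)) //.
  have nR : 0 < n%:R :> R by rewrite ltr0n.
  (* The condition s (n + 1) / n <= 1 amounts to n >= s / (1 - s), true for large n. *)
  rewrite mulrAC ler_pdivrMr // mul1r -natr1 mulrDr mulr1 -lerBrDl.
  rewrite [leRHS](_ : _ = n%:R * (1 - s)); last by ring.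
  rewrite -ler_pdivrMr ?subr_gt0 //.
  by near: n; exact: nbhs_infty_ger.
apply: cvg_EFin.
  near=> n; apply: fin; near: n; exact: nbhs_infty_gt.
move: t1; rewrite le_eqVlt => /predU1P[t1|]; last exact: lt1.
rewrite t1 subrr sqrtr0 mul0r; apply/cvgrPdist_le => e e0.
(* The limit at 1 - m is at most sqrt m <= e / 2; the cap 1 keeps 1 - m nonnegative. *)
pose m := Num.min 1 ((e / 2) ^+ 2).
have e2 : 0 < e / 2 by rewrite divr_gt0.
have m0 : 0 < m by rewrite lt_min ltr01 exprn_gt0.
have m1 : m <= 1 by rewrite ge_min lexx.
have s0 : 0 <= 1 - m by rewrite subr_ge0.
have s1 : 1 - m < 1 by rewrite gtrBl.
have me : Num.sqrt m <= e / 2.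
  rewrite -(ger0_norm (ltW e2)) -sqrtr_sqr.
  by apply: ler_wsqrtr; rewrite ge_min lexx orbT.
have Le : Num.sqrt (1 - (1 - m)) * expR (- (1 - m) / 2) <= e / 2.
  rewrite subKr; apply: le_trans me; rewrite ler_piMr ?sqrtr_ge0 // expR_le1.
  by rewrite mulNr oppr_le0 divr_ge0.
have /cvgrPdist_le/(_ _ e2) lim_s := lt1 _ s0 s1.
near=> n; have n0 : (0 < n)%N by near: n; exact: nbhs_infty_gt.
rewrite sub0r normrN ger0_norm ?fine_ge0 //.
(* The event for t = 1 lies in the event for 1 - m, whose probability is eventually within e / 2 of
   its limit. *)
apply: (@le_trans _ _ (fine (P n [set w | 1 - m <= min_scaled_partial_sum (U n) w]))).
  apply: fine_le; [exact: fin|exact: fin|].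
  apply: le_measure; rewrite ?inE; [exact: measurable_min_event|exact: measurable_min_event|].
  by move=> w /=; apply: le_trans; exact: ltW.
have : `|Num.sqrt (1 - (1 - m)) * expR (- (1 - m) / 2) -
    fine (P n [set w | 1 - m <= min_scaled_partial_sum (U n) w])| <= e / 2.
  by near: n.
rewrite ler_norml => /andP[+ _]; lra.
Unshelve. all: by end_near. Qed.
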